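(* For any simple planar polygon $P$ (vertices in general position), every area vector $\Phi(T)$, for $T$ a triangulation of $P$, lies on the hull (the boundary of the convex hull) of the secondary polytope $\Sigma(P)$.
   Context: Let $P$ have vertices $p_1,\ldots,p_n$. A triangulation $T$ of $P$ is a partition of $P$ into triangles by pairwise noncrossing diagonals (segments joining two vertices of $P$ lying in the interior of $P$). For a triangulation $T$, set $\phi(p_i)=\sum_{\Delta\in T,\ p_i\in\Delta}\mathrm{area}(\Delta)$, the sum of areas of triangles of $T$ having $p_i$ as a vertex, and define the area vector $\Phi(T)=(\phi(p_1),\ldots,\phi(p_n))\in\mathbb{R}^n$. The secondary polytope $\Sigma(P)$ is the convex hull of the area vectors of all triangulations of $P$. *)

(* Defs.v *)
From HB Require Import structures.
From mathcomp Require Import all_boot all_order all_algebra.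
From mathcomp Require Import all_classical all_reals all_analysis.

Set Implicit Arguments.
Unset Strict Implicit.
Unset Printing Implicit Defensive.

Import Order.TTheory GRing.Theory Num.Theory.
Import numFieldNormedType.Exports.

Local Open Scope classical_set_scope.
Local Open Scope ring_scope.

Section Hulls.
Context {R : realType} {m : nat}.
Implicit Types A : set 'rV[R]_m.

Definition conv_hull A : set 'rV[R]_m :=
  [set x | exists (k : nat) (c : 'I_k -> R) (y : 'I_k -> 'rV[R]_m),
     [/\ forall i, A (y i), forall i, 0 <= c i, \sum_i c i = 1
       & x = \sum_i c i *: y i]].

Definition aff_hull A : set 'rV[R]_m :=
  [set x | exists (k : nat) (c : 'I_k -> R) (y : 'I_k -> 'rV[R]_m),
     [/\ forall i, A (y i), \sum_i c i = 1
       & x = \sum_i c i *: y i]].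

Definition rel_interior A : set 'rV[R]_m :=
  [set x | A x /\ \forall y \near x, aff_hull A y -> A y].

Definition rel_boundary A : set 'rV[R]_m := closure A `\` rel_interior A.

(* The boundary of a polytope is taken inside its affine hull: the secondary
   polytope lies in the hyperplane where the coordinates sum to three times the
   area of the polygon, so it has empty interior in the ambient space and every
   point of it is in the ambient topological boundary.  A one-point polytope,
   whose relative boundary is empty, is its own boundary. *)
Definition polytope_boundary A : set 'rV[R]_m :=
  [set x | rel_boundary A x \/ A = [set x]].

End Hulls.

Section Plane.
Context {R : realType}.
Implicit Types a b c : 'rV[R]_2.

Definition closed_segment a b : set 'rV[R]_2 :=
  [set (1 - t) *: a + t *: b | t in [set t : R | 0 <= t <= 1]].

Definition open_segment a b : set 'rV[R]_2 :=
  [set (1 - t) *: a + t *: b | t in [set t : R | 0 < t < 1]].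

(* The determinant of (b - a, c - a), twice the signed area of abc. *)
Definition cross a b c : R :=
  (b 0 0 - a 0 0) * (c 0 1 - a 0 1) - (c 0 0 - a 0 0) * (b 0 1 - a 0 1).

Definition triangle_area a b c : R := `|cross a b c| / 2.

End Plane.

Section Polygon.
Context {R : realType} {n : nat}.
Variable p : 'I_n -> 'rV[R]_2.

(* [ordS] is the cyclic successor on ['I_n]; edge i joins p_i to p_(i+1). *)
Definition polygon_edge (i : 'I_n) : set 'rV[R]_2 :=
  closed_segment (p i) (p (ordS i)).

Definition simple_polygon : Prop :=
  [/\ (2 < n)%N, injective p
    & forall i j x, i != j -> polygon_edge i x -> polygon_edge j x ->
        exists k, [/\ (k == i) || (k == ordS i), (k == j) || (k == ordS j)
                    & x = p k]].

Definition general_position : Prop :=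
  forall i j k, i != j -> j != k -> i != k -> cross (p i) (p j) (p k) != 0.

Definition polygon_curve : set 'rV[R]_2 := \bigcup_(i in setT) polygon_edge i.

(* The bounded side of the Jordan curve. *)
Definition polygon_interior : set 'rV[R]_2 :=
  [set x | ~ polygon_curve x
           /\ bounded_set (connected_component (~` polygon_curve) x)].

Definition polygon_region : set 'rV[R]_2 := polygon_curve `|` polygon_interior.

Definition is_edge (s : 'I_n * 'I_n) : bool :=
  (s.2 == ordS s.1) || (s.1 == ordS s.2).

Definition is_diagonal (s : 'I_n * 'I_n) : Prop :=
  open_segment (p s.1) (p s.2) `<=` polygon_interior.

(* A triangle is encoded by its vertex indices, listed increasingly, so that
   triangles and their sides each have a unique code. *)
Definition triangle : finType := ('I_n * 'I_n * 'I_n)%type.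

Implicit Types (t u : triangle) (T : {set triangle}).

Definition increasing t : bool := (t.1.1 < t.1.2 < t.2)%N.

Definition vertices t : seq 'I_n := [:: t.1.1; t.1.2; t.2].

Definition sides t : seq ('I_n * 'I_n) :=
  [:: (t.1.1, t.1.2); (t.1.2, t.2); (t.1.1, t.2)].

Definition triangle_region t : set 'rV[R]_2 :=
  conv_hull [set p i | i in [set i | i \in vertices t]].

Definition area t : R := triangle_area (p t.1.1) (p t.1.2) (p t.2).

(* The segments by which T cuts the polygon. *)
Definition is_cut T (s : 'I_n * 'I_n) : Prop :=
  ~~ is_edge s /\ exists2 t, t \in T & s \in sides t.

Definition triangulation T : Prop :=
  [/\ forall t, t \in T -> increasing t,
      forall s, is_cut T s -> is_diagonal s,
      forall s s', is_cut T s -> is_cut T s' -> s != s' ->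
        open_segment (p s.1) (p s.2) `&` open_segment (p s'.1) (p s'.2) = set0,
      forall t u, t \in T -> u \in T -> t != u ->
        (triangle_region t)° `&` (triangle_region u)° = set0
    & \bigcup_(t in [set t | t \in T]) triangle_region t = polygon_region].

Definition area_vector T : 'rV[R]_n :=
  \row_i \sum_(t in T | i \in vertices t) area t.

Definition secondary_polytope : set 'rV[R]_n :=
  conv_hull [set area_vector T | T in triangulation].

End Polygon.

Arguments triangle : clear implicits.

(* Main.v *)
Require Import Defs.
From HB Require Import structures.
From mathcomp Require Import all_boot all_order all_algebra.
From mathcomp Require Import all_classical all_reals all_analysis.
From mathcomp Require Import ring lra.

(* Suppose a triangle t of T has a vertex v such that every other triangle of T
   at v belongs to all triangulations. Then the coordinate of v is minimal at T:
   in any triangulation T' the angle of t at v is filled by triangles reaching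
   at least to the side of t opposite to v, because no vertex of the polygon lies
   in t, so their total area is at least that of t, and it is larger if t is
   not in T'. Such a t is found among the triangles of T missing from some
   triangulation by minimizing the distance between its extreme indices, with v
   its middle vertex: diagonals of T do not interleave, so any other triangle at
   v is narrower. If there is no such triangle, T is the only triangulation.

   Two facts rest on the Jordan curve theorem, proved here for simple polygons
   with the crossing parity of rays: no vertex lies in a triangle of which it is not
   a corner, since every vertex is a limit of exterior points, and two interior
   diagonals with interleaved indices cross. *)


Set Implicit Arguments.
Unset Strict Implicit.
Unset Printing Implicit Defensive.
Import Order.TTheory GRing.Theory Num.Theory.
Import numFieldNormedType.Exports.
Local Open Scope classical_set_scope.
Local Open Scope ring_scope.

(** Being on the boundary relative to the affine hull takes more than a minimal coordinate: some
    other triangulation must have a strictly larger one. This is why [t] must be missing from some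
    triangulation, and why strictness is carried through all area estimates. The interior of the
    polygon is defined by bounded components, whereas diagonals are handled through parities; the
    bridge is that points of even parity are exterior. Its obstacle is that the exterior is not
    known in advance to touch every edge. This property is carried along an edge by connectedness
    and around a vertex by an explicit path, where general position makes the two edges linearly
    independent. Areas are not treated as measures. The triangles that fill the angle of [t] at [v]
    are projected from [v] to the opposite side of [t]; each has area at least its share of that
    side times the area of [t], so covering an interval by finitely many intervals is all that is
    needed. *)

(** * Determinants and segments in the plane *)

Section PlaneAlgebra.
Context {R : realType}.
Implicit Types a b c u v w x y z : 'rV[R]_2.

Definition det2 u v : R := u 0 0 * v 0 1 - v 0 0 * u 0 1.

Lemma vec2P u v : u 0 0 = v 0 0 -> u 0 1 = v 0 1 -> u = v.
Proof.
move=> h0 h1; apply/rowP => -[[|[|//]] i].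
- by rewrite (_ : Ordinal i = 0) //; apply/val_inj.
- by rewrite (_ : Ordinal i = 1) //; apply/val_inj.
Qed.

Lemma crossE a b c : cross a b c = det2 (b - a) (c - a).
Proof. by rewrite /cross /det2 !mxE. Qed.

Lemma segment_pointE (t : R) a b : (1 - t) *: a + t *: b = a + t *: (b - a).
Proof. by apply: vec2P; rewrite !mxE; ring. Qed.

Lemma closed_segmentP a b x :
  closed_segment a b x <-> exists2 t, 0 <= t <= 1 & x = a + t *: (b - a).
Proof.
split=> [[t t01 <-]|[t t01 ->]]; exists t => //; first exact: segment_pointE.
by rewrite segment_pointE.
Qed.

Lemma open_segmentP a b x :
  open_segment a b x <-> exists2 t, 0 < t < 1 & x = a + t *: (b - a).
Proof.
split=> [[t t01 <-]|[t t01 ->]]; exists t => //; first exact: segment_pointE.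
by rewrite segment_pointE.
Qed.

Lemma open_closed_segment a b : open_segment a b `<=` closed_segment a b.
Proof. by move=> x [t /andP[t0 t1] <-]; exists t; rewrite //= !ltW. Qed.

Lemma closed_segment_l a b : closed_segment a b a.
Proof. by apply/closed_segmentP; exists 0; rewrite ?lexx ?ler01// scale0r addr0. Qed.

Lemma closed_segment_r a b : closed_segment a b b.
Proof.
by apply/closed_segmentP; exists 1; rewrite ?lexx ?ler01// scale1r addrC subrK.
Qed.

Lemma closed_segmentC a b : closed_segment a b = closed_segment b a.
Proof.
by apply/seteqP; split=> x /closed_segmentP[t t01 ->]; apply/closed_segmentP;
   (exists (1 - t); first lra); apply: vec2P; rewrite !mxE; ring.
Qed.

Lemma open_segmentC a b : open_segment a b = open_segment b a.
Proof.
by apply/seteqP; split=> x /open_segmentP[t t01 ->]; apply/open_segmentP;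
   (exists (1 - t); first lra); apply: vec2P; rewrite !mxE; ring.
Qed.

Lemma closed_segment_cases a b x : closed_segment a b x ->
  [\/ x = a, x = b | open_segment a b x].
Proof.
move=> /closed_segmentP[t t01 ->].
have [->|t0] := eqVneq t 0; first by constructor 1; rewrite scale0r addr0.
have [->|t1] := eqVneq t 1; first by constructor 2; rewrite scale1r addrC subrK.
constructor 3; apply/open_segmentP; exists t => //.
by move/andP: t01 => [? ?]; rewrite !lt_neqAle t1 eq_sym t0; apply/andP.
Qed.

Lemma open_segment_neq a b x : a != b -> open_segment a b x -> x != a.
Proof.
move=> ab /open_segmentP[t /andP[t0 _] ->].
apply/eqP => /(canRL (addKr _)); rewrite addNr => /eqP.
by rewrite scaler_eq0 gt_eqF //= subr_eq0 eq_sym (negbTE ab).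
Qed.

Lemma open_segment_mid a b : open_segment a b (a + 2^-1 *: (b - a)).
Proof. by apply/open_segmentP; exists 2^-1 => //; lra. Qed.

(** Reduces a check along a subsegment to its starting point and the open segment: since [y] lies
    strictly inside, only [x] can be an endpoint. *)
Lemma subsegment_open a b x y :
  closed_segment a b x -> open_segment a b y ->
  forall z, closed_segment x y z -> z = x \/ open_segment a b z.
Proof.
move=> /closed_segmentP[s s01 ->] /open_segmentP[t t01 ->] z
  /closed_segmentP[r r01 ->].
have [->|r0] := eqVneq r 0; first by left; rewrite scale0r addr0.
right; apply/open_segmentP; exists (s + r * (t - s)); last first.
  by apply: vec2P; rewrite !mxE; ring.
have {}r0 : 0 < r by rewrite lt_neqAle eq_sym r0; case/andP: r01.
have [/andP[s0 s1] /andP[t0 t1] /andP[_ r1]] := And3 s01 t01 r01.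
by apply/andP; split; nra.
Qed.

End PlaneAlgebra.

(** * Neighbourhoods and closures tested along lines *)

Section Rays.
Context {R : realType} {V : normedModType R}.

Lemma near_ray (P : set V) (v : V) : nbhs v P -> forall d : V,
  exists2 e : R, 0 < e & forall s : R, `|s| <= e -> P (v + s *: d).
Proof.
move=> Pv d.
have : \forall s \near (0 : R), P (v + s *: d).
  have : (fun s : R => v + s *: d) @ (0 : R) --> v + 0 *: d.
    apply: cvgD; first exact: cvg_cst.
    by apply: cvgZr_tmp; exact: cvg_id.
  by rewrite scale0r addr0 => /(_ _ Pv).
move=> /nbhs_ballP[e /= e0 eP]; exists (e / 2); first by rewrite divr_gt0.
move=> s se; apply: eP; rewrite /ball /= sub0r normrN.
by apply: le_lt_trans se _; rewrite ltr_pdivrMr// ltr_pMr// ltr1n.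
Qed.

Lemma near_ray_pos (P : set V) (v : V) : nbhs v P -> forall d : V,
  exists2 e : R, 0 < e < 1 & P (v + e *: d).
Proof.
move=> /near_ray h d; have [e e0 eP] := h d; exists (Num.min e 2^-1).
  by apply/andP; split; rewrite ?lt_min ?gt_min ?e0 /= ?invr_gt0//;
     apply/orP; right; lra.
apply: eP; rewrite ger0_norm ?ge_min ?lexx//.
by rewrite le_min ltW//= invr_ge0.
Qed.

Lemma closure_ray (A : set V) (x d : V) (r : R) : 0 < r ->
  (forall s, 0 < s -> s < r -> A (x + s *: d)) -> closure A x.
Proof.
move=> r0 Ar B /near_ray h; have [e e0 eB] := h d.
exists (x + Num.min e (r / 2) *: d); split.
  apply: Ar; first by rewrite lt_min e0 divr_gt0.
  by rewrite gt_min ltr_pdivrMr// ltr_pMr// ltr1n orbT.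
apply: eB; rewrite ger0_norm ?ge_min ?lexx//.
by rewrite le_min !ltW// divr_gt0.
Qed.

End Rays.

(** * Topology of segments, continuity of affine functions *)

Section Segments.
Context {R : realType}.
Implicit Types a b x y : 'rV[R]_2.

Lemma segment_map_continuous a b :
  continuous (fun t : R => (1 - t) *: a + t *: b).
Proof.
move=> t; under eq_fun do rewrite segment_pointE.
apply: cvgD; first exact: cvg_cst.
by apply: cvgZr_tmp; exact: cvg_id.
Qed.

Lemma closed_segmentE a b :
  closed_segment a b = (fun t : R => (1 - t) *: a + t *: b) @` `[0, 1].
Proof.
by apply/seteqP; split=> x [t /= t01 <-]; exists t => //=; move: t01;
   rewrite in_itv.
Qed.

Lemma closed_segment_connected a b : connected (closed_segment a b).
Proof.
rewrite closed_segmentE; apply: connected_continuous_connected.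
  exact: segment_connected.
by apply: continuous_subspaceT; exact: segment_map_continuous.
Qed.

Lemma closed_segment_compact a b : compact (closed_segment a b).
Proof.
rewrite closed_segmentE; apply: continuous_compact; last exact: segment_compact.
by apply: continuous_subspaceT; exact: segment_map_continuous.
Qed.

Lemma closed_segment_closed a b : closed (closed_segment a b).
Proof.
by apply: compact_closed; [exact: norm_hausdorff|exact: closed_segment_compact].
Qed.

Lemma segment_component (A : set 'rV[R]_2) x y :
  closed_segment x y `<=` A -> connected_component A x y.
Proof.
move=> xyA; apply: (@connected_component_max _ A (closed_segment x y)) => //.
- exact: closed_segment_l.
- exact: closed_segment_connected.
- exact: closed_segment_r.
Qed.

Lemma affine_continuous (f : 'rV[R]_2 -> R) (c0 c1 c2 : R) :
  (forall y, f y = c0 + c1 * y 0 0 + c2 * y 0 1) -> continuous f.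
Proof.
move=> fE y; rewrite (funext fE).
have h i : (fun z : 'rV[R]_2 => z 0 i) @ nbhs y --> y 0 i.
  exact: coord_continuous.
exact: (cvgD (cvgD (cvg_cst c0) (cvgMl_tmp (a := c1) (h 0)))
  (cvgMl_tmp (a := c2) (h 1))).
Qed.

Lemma near_gt0 (f : 'rV[R]_2 -> R) x : {for x, continuous f} -> 0 < f x ->
  \forall y \near x, 0 < f y.
Proof. by move=> fx f0; have := fx _ (lt_nbhsr f0). Qed.

Lemma det2_continuous (w u : 'rV[R]_2) :
  continuous (fun y => det2 w (u - y)).
Proof.
apply: (affine_continuous (c0 := w 0 0 * u 0 1 - w 0 1 * u 0 0)
  (c1 := w 0 1) (c2 := - w 0 0)) => y.
by rewrite /det2 !mxE; ring.
Qed.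

Lemma det2l_continuous (d : 'rV[R]_2) : continuous (fun w => det2 w d).
Proof.
apply: (affine_continuous (c0 := 0) (c1 := d 0 1) (c2 := - d 0 0)) => y.
by rewrite /det2; ring.
Qed.

End Segments.

(** * Crossing parity of closed chains *)

Section Parity.
Context {R : realType}.
Implicit Types (u v w x y z : 'rV[R]_2) (ch : seq ('rV[R]_2 * 'rV[R]_2)).

Definition off_chain ch : set 'rV[R]_2 :=
  [set x | forall e, e \in ch -> ~ closed_segment e.1 e.2 x].

(* Closed modulo 2: every point is an endpoint of an even number of segments. *)
Definition closed_chain ch : Prop := forall g : 'rV[R]_2 -> bool,
  \big[addb/false]_(e <- ch) (g e.1 (+) g e.2) = false.

Definition generic ch x w : Prop := forall e, e \in ch ->
  det2 w (e.1 - x) != 0 /\ det2 w (e.2 - x) != 0.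

(* For generic w and x off the segment uv, this says that the ray from x in
   direction w meets uv: it does when w lies in the cone from u - x to v - x. *)
Definition ray_hits w x u v : bool :=
  ((0 < det2 w (u - x)) != (0 < det2 w (v - x))) &&
  ((0 < det2 w (v - x)) == (0 < det2 (u - x) (v - x))).

Definition crossings ch x w : bool :=
  \big[addb/false]_(e <- ch) ray_hits w x e.1 e.2.

(** The direction is an arbitrary generic one, with default [0]; for a closed chain and a point off
    it, [crossings_parity] shows that the choice does not matter. *)
Definition parity ch x : bool := crossings ch x (xget 0 (generic ch x)).

(** Cramer's rule with the denominator cleared. *)
Lemma det2_basis w u y :
  det2 w u *: y = det2 y u *: w + det2 w y *: u.
Proof. by apply: vec2P; rewrite /det2 !mxE; ring. Qed.

Lemma plucker w w' u v :
  det2 w w' * det2 u v = det2 w u * det2 w' v - det2 w v * det2 w' u.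
Proof. by rewrite /det2; ring. Qed.

(** The vectors [u - x] and [v - x] are parallel and point to opposite sides of the line through [x]
    in direction [w]. *)
Lemma on_segment w x u v :
  det2 w (u - x) != 0 -> det2 w (v - x) != 0 ->
  (0 < det2 w (u - x)) != (0 < det2 w (v - x)) ->
  det2 (u - x) (v - x) = 0 -> closed_segment u v x.
Proof.
set a := det2 w (u - x); set b := det2 w (v - x) => a0 b0 ab f0.
have : a *: (v - x) - b *: (u - x) = 0.
  apply: (scalerI a0); rewrite scaler0 {1}/a det2_basis.
  have -> : det2 (a *: (v - x) - b *: (u - x)) (u - x) =
    - (a * det2 (u - x) (v - x)) by rewrite /det2 !mxE; ring.
  have -> : det2 w (a *: (v - x) - b *: (u - x)) = 0.
    by rewrite /a /b /det2 !mxE; ring.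
  by rewrite f0 mulr0 oppr0 !scale0r addr0.
have ab0 : a - b != 0.
  by apply/eqP => h; move: ab; rewrite (_ : a = b) ?eqxx//; lra.
(* The affine function [det2 w (_ - x)] is [a] at [u] and [b] at [v], so it vanishes at this
   parameter. *)
move=> h; apply/closed_segmentP; exists (a / (a - b)).
  move: ab a0 b0 ab0; case: (ltgtP 0 a) => // ha; case: (ltgtP 0 b) => // hb _ _ _ _.
    by rewrite divr_ge0 ?ler_pdivrMr /=; lra.
  rewrite -mulrNN -invrN; apply/andP; split; first by rewrite divr_ge0; lra.
  by rewrite ler_pdivrMr; lra.
have hh : (a - b) *: x = a *: v - b *: u.
  move: h; rewrite !scalerBr => h; apply/eqP; rewrite -subr_eq0; apply/eqP.
  rewrite -[RHS]oppr0 -h; apply: vec2P; rewrite !mxE; ring.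
apply: (scalerI ab0); rewrite hh; apply: vec2P; rewrite !mxE; field; exact: ab0.
Qed.

(** Here [a], [b] are the determinants of [w] with the endpoints seen from [x], [c], [d] those of
    [w'], [e = det2 w w'], and [f] is the determinant of the endpoints; the equation is [plucker].
    Turning the ray from [w] to [w'] changes whether it hits the segment exactly when one endpoint
    lies in the sector swept. *)
Lemma sign_cases (a b c d e f : R) : a != 0 -> b != 0 -> c != 0 -> d != 0 ->
  0 < e -> e * f = a * d - b * c ->
  (f = 0 -> (0 < a) = (0 < b) /\ (0 < c) = (0 < d)) ->
  (((0 < a) != (0 < b)) && ((0 < b) == (0 < f))) (+)
  (((0 < c) != (0 < d)) && ((0 < d) == (0 < f))) =
  ((0 < a) && ~~ (0 < c)) (+) ((0 < b) && ~~ (0 < d)).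
Proof.
move=> a0 b0 c0 d0 e0 E.
case: (ltgtP 0 f) => hf; last first.
- move=> /(_ (esym hf))[-> ->]; rewrite !eqxx /=.
  by move: (0 < b) (0 < d) => [] [].
- move=> _; have ef : e * f < 0 by rewrite pmulr_rlt0.
  move: a0 b0 c0 d0; case: (ltgtP 0 a) => // ha; case: (ltgtP 0 b) => // hb;
  case: (ltgtP 0 c) => // hc; case: (ltgtP 0 d) => // hd _ _ _ _ //=; exfalso; nra.
- move=> _; have ef : 0 < e * f by rewrite pmulr_rgt0.
  move: a0 b0 c0 d0; case: (ltgtP 0 a) => // ha; case: (ltgtP 0 b) => // hb;
  case: (ltgtP 0 c) => // hc; case: (ltgtP 0 d) => // hd _ _ _ _ //=; exfalso; nra.
Qed.

Lemma crossings_det ch x w w' : closed_chain ch -> off_chain ch x ->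
  generic ch x w -> generic ch x w' -> 0 < det2 w w' ->
  crossings ch x w = crossings ch x w'.
Proof.
move=> cl off gw gw' ww'; apply/eqP; rewrite -[_ == _]negbK negb_eqb.
apply/negPf; rewrite /crossings -big_split /=.
(* The test function says that [u] lies in the sector at [x] from [w] to [w']. *)
apply: etrans (cl (fun u => (0 < det2 w (u - x)) && ~~ (0 < det2 w' (u - x)))).
apply: eq_big_seq => e ech; have [[u0 v0] [u0' v0']] := (gw _ ech, gw' _ ech).
apply: (@sign_cases _ _ _ _ (det2 w w')) => //; first by rewrite plucker.
by move=> f0; split; apply/eqP; apply: contraT => h; case: (off _ ech);
  [exact: (@on_segment w)|exact: (@on_segment w')].
Qed.

Lemma dense_generic (ds : seq 'rV[R]_2) (w : 'rV[R]_2) (O : set 'rV[R]_2) :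
  (forall d, d \in ds -> d != 0) -> open O -> O w ->
  exists2 w', O w' & forall d, d \in ds -> det2 w' d != 0.
Proof.
elim: ds w O => [|d ds IH] w O ds0 oO Ow; first by exists w.
have d0 : d != 0 by apply: ds0; rewrite mem_head.
pose O' := O `&` [set w' | det2 w' d != 0].
have oO' : open O'.
  apply: openI => //.
  apply: (@open_comp _ _ (fun w' => det2 w' d) [set c | c != 0]).
    by move=> z _; exact: det2l_continuous.
  exact: open_neq.
have [w' O'w'] : exists w', O' w'.
  have [wd|wd] := eqVneq (det2 w d) 0; last by exists w.
  (* This [n] is orthogonal to [d] and [det2 n d] is the squared length of [d], so any step along
     [n] makes the determinant nonzero. *)
  pose n : 'rV[R]_2 := \row_i (if i == 0 then d 0 1 else - d 0 0).
  have [e /andP[e0 _] Oe] := near_ray_pos (open_nbhs_nbhs (conj oO Ow)) n.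
  exists (w + e *: n); split => //=.
  have -> : det2 (w + e *: n) d = det2 w d + e * (d 0 0 ^+ 2 + d 0 1 ^+ 2).
    by rewrite /det2 !mxE /=; ring.
  rewrite wd add0r mulf_eq0 (gt_eqF e0) /= paddr_eq0 ?sqr_ge0// !sqrf_eq0.
  apply: contra d0 => /andP[/eqP h0 /eqP h1]; apply/eqP.
  by apply: vec2P; rewrite mxE.
have [d' d'ds|w'' [Ow'' dw''] h] := IH w' O' _ oO' O'w'.
  by apply: ds0; rewrite inE d'ds orbT.
by exists w'' => // d'; rewrite inE => /predU1P[->//|/h].
Qed.


Lemma generic_exists ch x (O : set 'rV[R]_2) w :
  (forall e, e \in ch -> e.1 != x /\ e.2 != x) -> open O -> O w ->
  exists2 w', O w' & generic ch x w'.
Proof.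
move=> ex oO Ow.
pose ds := [seq e.1 - x | e <- ch] ++ [seq e.2 - x | e <- ch].
have [d|w' Ow' hw'] := @dense_generic ds w O _ oO Ow.
  rewrite mem_cat => /orP[/mapP[e ech ->]|/mapP[e ech ->]]; rewrite subr_eq0;
  by have [] := ex _ ech.
exists w' => // e ech.
split; apply: hw'; rewrite mem_cat; apply/orP; [left|right]; apply/mapP;
by exists e.
Qed.

Lemma off_chain_endpoints ch x : off_chain ch x ->
  forall e, e \in ch -> e.1 != x /\ e.2 != x.
Proof.
move=> off e ech; split; apply/eqP => h; apply: (off _ ech); rewrite -h.
  exact: closed_segment_l.
exact: closed_segment_r.
Qed.

Lemma crossings_parity ch x w : closed_chain ch -> off_chain ch x ->
  generic ch x w -> parity ch x = crossings ch x w.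
Proof.
move=> cl off gw; rewrite /parity; case: xgetP => [w' _ gw'|/(_ w)//].
have det2C (u v : 'rV[R]_2) : det2 u v = - det2 v u by rewrite /det2; ring.
have [ch0|[e0 e0ch]] : ch = [::] \/ exists e, e \in ch.
  by case: (ch) => [|e ch']; [left|right; exists e; rewrite mem_head].
  by rewrite ch0 /crossings !big_nil.
have wn0 v : generic ch x v -> v != 0.
  move=> /(_ _ e0ch)[h _]; apply: contra h => /eqP ->.
  by rewrite /det2 !mxE !mul0r mulr0 subr0.
(* The directions [w] and [w'] may be parallel, a case that [crossings_det] does not reach, so both
   are compared with a third one. The extra segment from [x + w] to [x + w'] makes [w''] parallel to
   neither. *)
have [e|w'' _ gw''] :=
    @generic_exists ((x + w, x + w') :: ch) x setT 0 _ openT I.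
  rewrite inE => /predU1P[->|/(off_chain_endpoints off)//] /=.
  by rewrite -2![_ == x]subr_eq0 ![x + _]addrC !addrK !wn0.
have gww'' : generic ch x w'' by move=> e ech; apply: gw''; rewrite inE ech orbT.
have [] := gw'' _ (mem_head _ _); rewrite /= ![x + _]addrC !addrK => d1 d2.
have aux v : det2 w'' v != 0 -> generic ch x v ->
    crossings ch x v = crossings ch x w''.
  case: (ltgtP 0 (det2 w'' v)) => // h _ gv; last first.
    by apply: crossings_det => //; rewrite det2C oppr_gt0.
  by apply/esym/crossings_det.
by rewrite (aux w) ?(aux w').
Qed.

End Parity.

(** * Local constancy of the parity, and first hits of rays *)

Section ParityTopology.
Context {R : realType}.
Implicit Types (u v w x y z : 'rV[R]_2) (ch : seq ('rV[R]_2 * 'rV[R]_2)).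

Lemma near_sign (f : 'rV[R]_2 -> R) x : {for x, continuous f} -> f x != 0 ->
  \forall y \near x, f y != 0 /\ (0 < f y) = (0 < f x).
Proof.
move=> fc; case: (ltgtP 0 (f x)) => // h _.
  by apply: filterS (near_gt0 fc h) => y hy; rewrite hy gt_eqF.
have : \forall y \near x, 0 < - f y by apply: near_gt0; [exact: continuousN|rewrite oppr_gt0].
by apply: filterS => y; rewrite oppr_gt0 => hy; rewrite (lt_gtF hy) lt_eqF.
Qed.

Lemma near_forall_seq (T : topologicalType) (I : eqType) (s : seq I)
    (x : T) (P : I -> T -> Prop) :
  (forall i, i \in s -> \forall y \near x, P i y) ->
  \forall y \near x, forall i, i \in s -> P i y.
Proof.
elim: s => [|i s IH] h; first exact: nearW.
have h1 := h i (mem_head _ _).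
have h2 := IH (fun j js => h j (@mem_behead _ (i :: s) _ js)).
by apply: filterS2 h1 h2 => y Pi Ps j; rewrite inE => /predU1P[->//|/Ps].
Qed.

Lemma off_chain_near ch x : off_chain ch x -> \forall y \near x, off_chain ch y.
Proof.
move=> off; apply: near_forall_seq => e ech.
have := @closed_segment_closed R e.1 e.2; rewrite -openC openE => /(_ x); apply.
exact: off.
Qed.

(** If the line in direction [w] separates [u] from [v], then off the segment the third determinant
    is nonzero and all three signs are stable; if not, the ray misses whatever the third sign is. *)
Lemma ray_hits_near w x u v : ~ closed_segment u v x ->
  det2 w (u - x) != 0 -> det2 w (v - x) != 0 ->
  \forall y \near x, [/\ det2 w (u - y) != 0, det2 w (v - y) != 0 &
     ray_hits w y u v = ray_hits w x u v].
Proof.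
move=> xuv u0 v0.
have hu := near_sign (@det2_continuous _ w u x) u0.
have hv := near_sign (@det2_continuous _ w v x) v0.
have [eqs|nes] := eqVneq (0 < det2 w (u - x)) (0 < det2 w (v - x)).
  apply: filterS2 hu hv => y [y1 y2] [y3 y4]; split => //.
  by rewrite /ray_hits y2 y4 eqs eqxx.
have f0 : det2 (u - x) (v - x) != 0.
  by apply/eqP => f0; apply: xuv; exact: (@on_segment _ w).
have fc : continuous (fun y => det2 (u - y) (v - y)).
  apply: (affine_continuous (c0 := u 0 0 * v 0 1 - v 0 0 * u 0 1)
    (c1 := u 0 1 - v 0 1) (c2 := v 0 0 - u 0 0)) => y.
  by rewrite /det2 !mxE; ring.
have hf := near_sign (fc x) f0.
apply: filterS3 hu hv hf => y [y1 y2] [y3 y4] [_ y5]; split => //.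
by rewrite /ray_hits y2 y4 y5.
Qed.

Lemma crossings_near ch x w : off_chain ch x -> generic ch x w ->
  \forall y \near x, generic ch y w /\ crossings ch y w = crossings ch x w.
Proof.
move=> off gw.
have : \forall y \near x, forall e, e \in ch ->
    [/\ det2 w (e.1 - y) != 0, det2 w (e.2 - y) != 0 &
     ray_hits w y e.1 e.2 = ray_hits w x e.1 e.2].
  apply: near_forall_seq => e ech; have [? ?] := gw _ ech.
  by apply: ray_hits_near => //; exact: off.
apply: filterS => y hy; split; first by move=> e /hy[].
by apply: eq_big_seq => e /hy[].
Qed.

Lemma parity_near ch x : closed_chain ch -> off_chain ch x ->
  \forall y \near x, off_chain ch y /\ parity ch y = parity ch x.
Proof.
move=> cl off.
have [w _ gw] := generic_exists (w := 0) (off_chain_endpoints off) openT I.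
apply: filterS2 (off_chain_near off) (crossings_near off gw) => y offy [gy cy].
by split => //; rewrite (crossings_parity cl offy gy) cy -crossings_parity.
Qed.

Lemma parity_connected ch (A : set 'rV[R]_2) x y : closed_chain ch ->
  connected A -> A `<=` off_chain ch -> A x -> A y -> parity ch x = parity ch y.
Proof.
move=> cl cA Aoff Ax Ay.
have op (b : bool) : open [set z | off_chain ch z /\ parity ch z = b].
  rewrite openE => z [offz <-].
  exact: parity_near.
suff E : A `&` [set z | off_chain ch z /\ parity ch z = parity ch y] = A.
  by move: Ax; rewrite -E => -[_ []].
apply: cA; first by exists y; split => //; split => //; exact: Aoff.
- by eexists; first exact: (op (parity ch y)).
- exists (~` [set z | off_chain ch z /\ parity ch z = ~~ parity ch y]).
    by rewrite closedC; exact: op.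
  apply/seteqP; split=> z [Az /=].
    by move=> [offz ->]; split => // -[_]; case: (parity ch y).
  move=> h; split => //; split; first exact: Aoff.
  apply/eqP; rewrite -[_ == _]negbK; apply/negP => h'; apply: h.
  by split; [exact: Aoff|move: h'; rewrite negb_eqb; do 2 case: parity].
Qed.

Lemma parity_segment ch x y : closed_chain ch ->
  closed_segment x y `<=` off_chain ch -> parity ch x = parity ch y.
Proof.
move=> cl xy; apply: (parity_connected cl (@closed_segment_connected _ x y) xy).
  exact: closed_segment_l.
exact: closed_segment_r.
Qed.

Lemma line_hit w x u v (s s' : R) : det2 w (u - x) != 0 -> det2 w (v - x) != 0 ->
  closed_segment u v (x + s *: w) -> closed_segment u v (x + s' *: w) -> s = s'.
Proof.
move=> u0 v0 /closed_segmentP[t t01 h] /closed_segmentP[t' t01' h'].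
have key r q : x + r *: w = u + q *: (v - u) ->
    (1 - q) * det2 w (u - x) + q * det2 w (v - x) = 0.
  move=> hr; have -> : (1 - q) * det2 w (u - x) + q * det2 w (v - x) =
    det2 w (u + q *: (v - u) - x) by rewrite /det2 !mxE; ring.
  by rewrite -hr /det2 !mxE; ring.
have := key _ _ h; have := key _ _ h'; move: u0 v0.
set a := det2 w (u - x); set b := det2 w (v - x) => a0 b0 k' k.
have ab : b - a != 0.
  apply/eqP => ba; move/eqP: a0; apply; have e : b = a by lra.
  by move: k; rewrite e => k; lra.
have tt' : t = t'.
  by apply: (mulfI ab); lra.
have w0 : w != 0.
  by apply: contra a0 => /eqP w0; rewrite /a w0 /det2 !mxE !mul0r mulr0 subr0.
have : (s - s') *: w = 0.
  rewrite scalerBl; apply: (addrI x); rewrite addrA addr0 h tt' -h'.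
  by rewrite addrK.
by move=> /eqP; rewrite scaler_eq0 (negbTE w0) orbF subr_eq0 => /eqP.
Qed.

(** A generic line meets each segment at most once, by [line_hit], so the induction only compares
    the parameter on the new segment with the first one on the rest. Genericity keeps hits away from
    endpoints. *)
Lemma first_hit ch x w : off_chain ch x -> generic ch x w ->
  (forall s, 0 <= s -> off_chain ch (x + s *: w)) \/
  exists e s, [/\ e \in ch, 0 < s, open_segment e.1 e.2 (x + s *: w) &
    forall s', 0 <= s' -> s' < s -> off_chain ch (x + s' *: w)].
Proof.
elim: ch => [|e ch IH] off gw; first by left.
have offe : ~ closed_segment e.1 e.2 x by apply: off; rewrite mem_head.
have [u0 v0] := gw e (mem_head _ _).
have {IH} := IH (fun f fch => off f (@mem_behead _ (e :: ch) _ fch))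
  (fun f fch => gw f (@mem_behead _ (e :: ch) _ fch)).
have [[s [s0 hs]]|miss] := pselect (exists s, 0 <= s /\
    closed_segment e.1 e.2 (x + s *: w)); last first.
  move=> [miss'|[f [s [fch s0 fs hs]]]].
    left=> s s0 f; rewrite inE => /predU1P[->|/miss']; last exact.
    by move=> h; apply: miss; exists s.
  right; exists f, s; split => //; first by rewrite inE fch orbT.
  move=> s' s'0 s's g; rewrite inE => /predU1P[->|/hs]; last exact.
  by move=> h; apply: miss; exists s'.
have os : open_segment e.1 e.2 (x + s *: w).
  have dw : det2 w (x + s *: w - x) = 0 by rewrite /det2 !mxE; ring.
  case: (closed_segment_cases hs) => // h.
    by move: u0; rewrite -h dw eqxx.
  by move: v0; rewrite -h dw eqxx.
have {}s0 : 0 < s.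
  rewrite lt_neqAle s0 andbT; apply/eqP => s00; apply: offe.
  by move: hs; rewrite -s00 scale0r addr0.
have eoff s' : s' < s -> ~ closed_segment e.1 e.2 (x + s' *: w).
  by move=> s's h; move: s's; rewrite (line_hit u0 v0 h hs) ltxx.
move=> [miss'|[f [r [fch r0 fr hr]]]].
  right; exists e, s; split => //; first exact: mem_head.
  move=> s' s'0 s's g; rewrite inE => /predU1P[->|]; first exact: eoff.
  exact: miss'.
right; have [rs|sr] := ltP r s.
  exists f, r; split => //; first by rewrite inE fch orbT.
  move=> s' s'0 s'r g; rewrite inE => /predU1P[->|]; last exact: hr.
  by apply: eoff; exact: lt_trans rs.
exists e, s; split => //; first exact: mem_head.
move=> s' s'0 s's g; rewrite inE => /predU1P[->|]; first exact: eoff.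
by apply: hr => //; exact: lt_le_trans sr.
Qed.

Lemma miss_crossings ch x w : generic ch x w ->
  (forall s, 0 <= s -> off_chain ch (x + s *: w)) -> crossings ch x w = false.
Proof.
move=> gw miss; rewrite /crossings big_seq; apply: big1 => e ech.
apply/negbTE/negP => /andP[].
have [a0 b0] := gw _ ech; move: a0 b0.
set U := e.1 - x; set V := e.2 - x; set a := det2 w U; set b := det2 w V.
move=> a0 b0 ab bf.
have ab0 : b - a != 0.
  by apply/eqP => h; move: ab; rewrite (_ : a = b) ?eqxx//; lra.
have f0 : det2 U V != 0.
  apply/eqP => f0; apply: (miss 0 (lexx _) _ ech); rewrite scale0r addr0.
  exact: (@on_segment _ w).
(* Since [det2 U V *: w = b *: U - a *: V], the line through [x] meets the segment at this multiple
   of [w]; the sign condition in [ray_hits] makes it nonnegative. *)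
apply: (miss (det2 U V / (b - a)) _ _ ech).
  move: ab bf a0 b0 f0; case: (ltgtP 0 a) => // ha; case: (ltgtP 0 b) => // hb;
  case: (ltgtP 0 (det2 U V)) => // hf _ _ _ _ _.
    by rewrite -mulrNN -invrN divr_ge0; lra.
  by rewrite divr_ge0; lra.
apply/closed_segmentP; exists (- a / (b - a)).
  move: ab a0 b0; case: (ltgtP 0 a) => // ha; case: (ltgtP 0 b) => // hb _ _ _.
    rewrite -mulrNN -invrN opprK; apply/andP; split; first by rewrite divr_ge0; lra.
    by rewrite ler_pdivrMr; lra.
  by rewrite divr_ge0 ?ler_pdivrMr /=; lra.
have h : det2 U V *: w = b *: U - a *: V.
  by rewrite /a /b; apply: vec2P; rewrite /det2 !mxE; ring.
apply: (scalerI ab0).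
rewrite scalerDr scalerA mulrCA divff // mulr1 h.
apply: vec2P; rewrite /U /V !mxE; field; exact: ab0.
Qed.

(* Moving across e along w changes exactly one term of the crossing count. *)
Lemma parity_flip ch e z w : closed_chain (e :: ch) -> off_chain ch z ->
  open_segment e.1 e.2 z -> generic (e :: ch) z w ->
  exists2 d : R, 0 < d & forall s, 0 < s -> s <= d ->
    [/\ off_chain (e :: ch) (z + s *: w), off_chain (e :: ch) (z - s *: w) &
        parity (e :: ch) (z + s *: w) = ~~ parity (e :: ch) (z - s *: w)].
Proof.
move=> cl off /open_segmentP[t /andP[t0 t1] zE] gw.
have gw' : generic ch z w by move=> f fch; apply: gw; rewrite inE fch orbT.
have [d d0 hd] := near_ray
  (filterI (off_chain_near off) (crossings_near off gw')) w.
set D := det2 w (e.2 - e.1).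
have aE r : det2 w (e.1 - (z + r *: w)) = - t * D.
  by rewrite zE /D /det2 !mxE; ring.
have bE r : det2 w (e.2 - (z + r *: w)) = (1 - t) * D.
  by rewrite zE /D /det2 !mxE; ring.
have fE r : det2 (e.1 - (z + r *: w)) (e.2 - (z + r *: w)) = - r * D.
  by rewrite zE /D /det2 !mxE; ring.
have D0 : D != 0.
  have [h _] := gw e (mem_head _ _); move: h.
  have := aE 0; rewrite scale0r addr0 => ->.
  by rewrite mulf_eq0 negb_or => /andP[].
have gen r : `|r| <= d -> generic (e :: ch) (z + r *: w) w.
  move=> rd f; rewrite inE => /predU1P[->|fch].
    rewrite aE bE !mulf_eq0 (negbTE D0) !orbF oppr_eq0 (gt_eqF t0).
    by rewrite subr_eq0 (gt_eqF t1).
  by have [_ [h _]] := hd r rd; exact: h.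
have offr r : r != 0 -> `|r| <= d -> off_chain (e :: ch) (z + r *: w).
  move=> r0 rd f; rewrite inE => /predU1P[->|fch]; last first.
    by have [h _] := hd r rd; exact: h.
  move=> /closed_segmentP[q _ h].
  have : det2 (e.1 - (z + r *: w)) (e.2 - (z + r *: w)) = 0.
    by rewrite h /det2 !mxE; ring.
  by rewrite fE => /eqP; rewrite mulf_eq0 oppr_eq0 (negbTE r0) (negbTE D0).
(* Seen along [w], the point [z + r *: w] is in front of the segment exactly when [r < 0]. *)
have hits r : r != 0 -> ray_hits w (z + r *: w) e.1 e.2 = (r < 0).
  have t1' : 0 < 1 - t by rewrite subr_gt0.
  move=> r0; rewrite /ray_hits aE bE fE.
  rewrite mulNr oppr_gt0 pmulr_rlt0// !(pmulr_rgt0 _ t1') mulNr oppr_gt0.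
  move: D0; case: (ltgtP 0 D) => // hD _ /=.
    by rewrite pmulr_llt0 //; case: (r < 0).
  by rewrite nmulr_llt0 //; move: r0; case: (ltgtP r 0).
have parE r : r != 0 -> `|r| <= d ->
    parity (e :: ch) (z + r *: w) = (r < 0) (+) crossings ch z w.
  move=> r0 rd; rewrite (crossings_parity cl (offr _ r0 rd) (gen _ rd)).
  rewrite /crossings big_cons hits // -/(crossings _ _ _).
  by have [_ [_ ->]] := hd r rd.
exists d => // s s0 sd; rewrite -scaleNr.
have [sn0 sn0'] : s != 0 /\ - s != 0 by rewrite oppr_eq0 gt_eqF.
have [ds ds'] : `|s| <= d /\ `|- s| <= d by rewrite normrN gtr0_norm.
by split; [exact: offr|exact: offr|rewrite !parE // oppr_lt0 s0 ltNge ltW//= negbK].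
Qed.

End ParityTopology.

(** * The exterior of a simple polygon *)

Section Exterior.
Context {R : realType} {n : nat}.
Variable p : 'I_n -> 'rV[R]_2.
Hypothesis p_simple : simple_polygon p.
Implicit Types (i j k m : 'I_n) (u v w x y z : 'rV[R]_2).

Local Notation curve := (polygon_curve p).
Local Notation edge := (polygon_edge p).
Local Notation open_edge k := (open_segment (p k) (p (ordS k))).

Definition boundary_chain : seq ('rV[R]_2 * 'rV[R]_2) :=
  [seq (p i, p (ordS i)) | i <- enum 'I_n].

Lemma boundary_chainP e :
  e \in boundary_chain <-> exists i, e = (p i, p (ordS i)).
Proof.
split=> [/mapP[i _ ->]|[i ->]]; first by exists i.
by apply: map_f; rewrite mem_enum.
Qed.

Lemma off_boundary x : off_chain boundary_chain x <-> ~ curve x.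
Proof.
split=> [off [i _ xi]|ncx e /boundary_chainP[i ->] xi].
  by apply: (off (p i, p (ordS i))) => //; apply/boundary_chainP; exists i.
by apply: ncx; exists i.
Qed.

Lemma boundary_closed : closed_chain boundary_chain.
Proof.
move=> g; rewrite /boundary_chain big_map big_enum /= big_split /=.
by rewrite (reindex_inj (@ordS_inj n)) /= addbb.
Qed.

Lemma val_iter_ordS k r : iter r (@ordS n) k = ((k + r) %% n)%N :> nat.
Proof.
elim: r => [|r IH] /=; first by rewrite addn0 modn_small.
by rewrite IH -[X in (X %% n)%N]addn1 modnDml addn1 addnS.
Qed.

Lemma ordS_ind (P : 'I_n -> Prop) k : (forall i, P i -> P (ordS i)) ->
  P k -> forall i, P i.
Proof.
move=> PS Pk i.
have Pit r : P (iter r (@ordS n) k) by elim: r => //= r; exact: PS.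
suff <- : iter (n - k + i) (@ordS n) k = i by [].
apply: ord_inj; rewrite val_iter_ordS addnA subnKC; last exact: ltnW.
by rewrite modnDl modn_small.
Qed.

Lemma ordS_neq i : ordS i != i.
Proof.
have [n2 _ _] := p_simple; apply/eqP => /(congr1 val) /=.
have := ltn_ord i; rewrite leq_eqVlt => /predU1P[E|lt].
  have -> : (i.+1 %% n)%N = 0%N by rewrite E modnn.
  by move=> i0; move: n2; rewrite -E -i0.
by rewrite modn_small // => /esym; exact: n_Sn.
Qed.

Lemma ordS2_neq i : ordS (ordS i) != i.
Proof.
have [n2 _ _] := p_simple; apply/eqP => /(congr1 val) /=.
have := val_iter_ordS i 2; rewrite /= => -> /eqP.
rewrite -[X in _ == X](modn_small (ltn_ord i)) -[X in _ == X %[mod _]]addn0.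
by rewrite eqn_modDl mod0n modn_small.
Qed.

Lemma edge_neq i : p i != p (ordS i).
Proof.
have [_ inj _] := p_simple.
by apply/eqP => /inj /eqP; rewrite eq_sym (negbTE (ordS_neq i)).
Qed.

Lemma open_edge_uniq k j z : open_edge k z -> edge j z -> j = k.
Proof.
move=> kz jz; have [_ _ hs] := p_simple.
apply/eqP/negPn/negP => jk.
have [m [_ mk zm]] := hs j k z jk jz (open_closed_segment kz).
case/orP: mk => /eqP mk; move: kz; rewrite zm mk => kz.
  by have := open_segment_neq (edge_neq k) kz; rewrite eqxx.
rewrite open_segmentC in kz.
by have := open_segment_neq _ kz; rewrite eq_sym edge_neq eqxx => /(_ isT).
Qed.

Lemma vertex_edge j m : edge j (p m) -> m = j \/ m = ordS j.
Proof.
move=> jm; have [_ inj hs] := p_simple.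
have [->|mj] := eqVneq m j; first by left.
have [k [_ kj /inj ->]] := hs m j _ mj (closed_segment_l _ _) jm.
by case/orP: kj => /eqP; [left|right].
Qed.

Lemma open_edge_vertex k m : ~ open_edge k (p m).
Proof.
move=> h; have /(open_edge_uniq h) E := closed_segment_l (p m) (p (ordS m)).
by move: h; rewrite E => /(open_segment_neq (edge_neq k)); rewrite eqxx.
Qed.

Lemma edge_near j x : ~ edge j x -> \forall y \near x, ~ edge j y.
Proof.
move=> jx; have := @closed_segment_closed R (p j) (p (ordS j)).
by rewrite -openC openE => /(_ x); apply.
Qed.

(** The edges outside [s] are finitely many closed sets that miss [x]. *)
Lemma curve_near x (s : pred 'I_n) : (forall j, edge j x -> s j) ->
  \forall y \near x, curve y -> exists2 j, s j & edge j y.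
Proof.
move=> sx.
have : \forall y \near x, forall j, j \in [seq j <- enum 'I_n | ~~ s j] ->
    ~ edge j y.
  apply: near_forall_seq => j; rewrite mem_filter => /andP[/negP sj _].
  exact: edge_near (contra_not (sx j) sj).
apply: filterS => y hy [j _ jy]; exists j => //.
apply/negPn/negP => sj; apply: (hy j) => //.
by rewrite mem_filter sj mem_enum.
Qed.

Definition exterior : set 'rV[R]_2 := ~` polygon_region p.

Lemma exteriorP x : exterior x <->
  ~ curve x /\ ~ bounded_set (connected_component (~` curve) x).
Proof.
rewrite /exterior /polygon_region /polygon_interior /setC /setU /=.
split=> [h|[h1 h2] []// [_]//].
have h1 : ~ curve x by move=> h1; apply: h; left.
by split=> // h2; apply: h; right.
Qed.

Lemma exterior_connected (A : set 'rV[R]_2) x y : connected A ->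
  A `<=` ~` curve -> A x -> A y -> exterior x -> exterior y.
Proof.
move=> cA Ac Ax Ay /exteriorP[_ ubx]; apply/exteriorP; split; first exact: Ac.
suff <- : connected_component (~` curve) x = connected_component (~` curve) y by [].
by apply: same_connected_component; exact: (connected_component_max Ax Ac cA).
Qed.

Lemma exterior_segment x y : closed_segment x y `<=` ~` curve ->
  exterior x -> exterior y.
Proof.
move=> h; apply: (exterior_connected (@closed_segment_connected _ x y) h).
  exact: closed_segment_l.
exact: closed_segment_r.
Qed.

Lemma exterior_ray x w : w != 0 ->
  (forall s : R, 0 <= s -> ~ curve (x + s *: w)) -> exterior x.
Proof.
move=> w0 miss; apply/exteriorP; split.
  by have := miss 0 (lexx _); rewrite scale0r addr0.
move=> [M [_ hM]]; have w0' : 0 < `|w| by rewrite normr_gt0.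
(* Chosen so that the point at [s] has norm at least one more than the absolute value of [M]; as
   boundedness only gives bounds strictly above [M], it is applied half a unit above that value. *)
pose s := (`|M| + 1 + `|x|) / `|w|.
have s0 : 0 <= s by rewrite divr_ge0 // !addr_ge0.
have : connected_component (~` curve) x (x + s *: w).
  apply: segment_component => y /closed_segmentP[t /andP[t0 _] ->].
  rewrite (_ : x + t *: (x + s *: w - x) = x + (t * s) *: w).
    by apply: miss; exact: mulr_ge0.
  by apply: vec2P; rewrite !mxE; ring.
move=> /(hM (`|M| + 2^-1)) /=.
have -> : M < `|M| + 2^-1.
  by rewrite (le_lt_trans (ler_norm M)) // ltrDl invr_gt0.
move=> /(_ isT); apply/negP; rewrite -ltNge.
have : `|s *: w| <= `|x + s *: w| + `|x|.
  by have := ler_normB (x + s *: w) x; rewrite [x + _]addrC addrK.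
rewrite normrZ (ger0_norm s0) /s divfK ?gt_eqF // => h.
by apply: lt_le_trans (_ : `|M| + 1 <= _); lra.
Qed.

Lemma curve_bounded : exists2 B : R, 0 <= B & forall y, curve y -> `|y| <= B.
Proof.
exists (\sum_i (`|p i| + `|p (ordS i)|)).
  by apply: sumr_ge0 => i _; exact: addr_ge0.
move=> y [i _ [t /andP[t0 t1] <-]].
apply: (@le_trans _ _ (`|p i| + `|p (ordS i)|)); last first.
  by rewrite (bigD1 i) //= lerDl; apply: sumr_ge0 => j _; exact: addr_ge0.
apply: le_trans (ler_normD _ _) _; rewrite !normrZ !ger0_norm ?subr_ge0 //.
by apply: lerD; rewrite ler_piMl //; lra.
Qed.

Lemma cross_affine u v x y (t : R) :
  cross u v (x + t *: (y - x)) = (1 - t) * cross u v x + t * cross u v y.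
Proof. by rewrite /cross !mxE; ring. Qed.

Lemma ball_segment x (d : R) y y' z : ball x d y -> ball x d y' ->
  closed_segment y y' z -> ball x d z.
Proof.
rewrite !mx_norm_ball /ball_ /= => xy xy' [t /andP[t0 t1] <-].
have -> : x - ((1 - t) *: y + t *: y') = (1 - t) *: (x - y) + t *: (x - y').
  by apply: vec2P; rewrite !mxE; ring.
apply: le_lt_trans (ler_normD _ _) _.
rewrite !normrZ !ger0_norm ?subr_ge0 //.
have [->|t0'] := eqVneq t 0; first by rewrite subr0 mul1r mul0r addr0.
have {}t0 : 0 < t by rewrite lt_neqAle eq_sym t0'.
have h1 : t * `|x - y'| < t * d by rewrite ltr_pM2l.
have h2 : (1 - t) * `|x - y| <= (1 - t) * d.
  by rewrite ler_wpM2l ?subr_ge0 // ltW.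
by lra.
Qed.

Lemma sqr_norm_gt0 u v : u != v ->
  0 < (v 0 0 - u 0 0) ^+ 2 + (v 0 1 - u 0 1) ^+ 2.
Proof.
move=> uv; rewrite lt_neqAle addr_ge0 ?sqr_ge0 // andbT eq_sym.
rewrite paddr_eq0 ?sqr_ge0 // !sqrf_eq0 !subr_eq0.
apply: contra uv => /andP[/eqP h0 /eqP h1]; apply/eqP.
by apply: vec2P.
Qed.

Lemma line_near u v z : u != v -> open_segment u v z ->
  \forall y \near z, cross u v y = 0 -> open_segment u v y.
Proof.
move=> uv /open_segmentP[t /andP[t0 t1] zE].
set N := (v 0 0 - u 0 0) ^+ 2 + (v 0 1 - u 0 1) ^+ 2.
have N0 : 0 < N := sqr_norm_gt0 uv.
(* The orthogonal projection to the line [uv], expressed as the parameter from [u] to [v]. *)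
pose f y := ((y 0 0 - u 0 0) * (v 0 0 - u 0 0) +
             (y 0 1 - u 0 1) * (v 0 1 - u 0 1)) / N.
have fz : f z = t.
  by rewrite /f zE /N !mxE; field; rewrite -/N; apply: lt0r_neq0; exact: N0.
have fc : continuous f.
  apply: (affine_continuous
    (c0 := - (u 0 0 * (v 0 0 - u 0 0) + u 0 1 * (v 0 1 - u 0 1)) / N)
    (c1 := (v 0 0 - u 0 0) / N) (c2 := (v 0 1 - u 0 1) / N)) => y.
  by rewrite /f; field; apply: lt0r_neq0.
have n1 : \forall y \near z, 0 < f y by apply: near_gt0; rewrite ?fz//; exact: fc.
have n2 : \forall y \near z, 0 < 1 - f y.
  apply: (@near_gt0 _ (fun y => 1 - f y)); rewrite ?fz ?subr_gt0//.
  by apply: continuousB; [exact: cst_continuous|exact: fc].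
apply: filterS2 n1 n2 => y f0 f1 c0; apply/open_segmentP; exists (f y).
  by rewrite f0; lra.
have fN : f y * N = (y 0 0 - u 0 0) * (v 0 0 - u 0 0) +
             (y 0 1 - u 0 1) * (v 0 1 - u 0 1) by rewrite /f divfK ?gt_eqF.
apply: vec2P; rewrite !mxE; apply: (mulIf (lt0r_neq0 N0));
  rewrite mulrDl mulrAC fN /N; apply/eqP; rewrite -subr_eq0; apply/eqP.
- transitivity (- (v 0 1 - u 0 1) * cross u v y); last by rewrite c0 mulr0.
  by rewrite /cross; ring.
- transitivity ((v 0 0 - u 0 0) * cross u v y); last by rewrite c0 mulr0.
  by rewrite /cross; ring.
Qed.

End Exterior.

(** * The Jordan curve theorem: interior points have odd parity *)

Section Jordan.
Context {R : realType} {n : nat}.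
Variable p : 'I_n -> 'rV[R]_2.
Hypothesis p_simple : simple_polygon p.
Hypothesis p_general : general_position p.
Implicit Types (i j k m : 'I_n) (u v w x y z : 'rV[R]_2).

Local Notation curve := (polygon_curve p).
Local Notation edge := (polygon_edge p).
Local Notation open_edge k := (open_segment (p k) (p (ordS k))).
Local Notation ext := (exterior p).

Lemma edge_cross k y : edge k y -> cross (p k) (p (ordS k)) y = 0.
Proof. by move=> /closed_segmentP[t _ ->]; rewrite /cross !mxE; ring. Qed.

Lemma convex_gt0 (a b t : R) : 0 < a -> 0 < b -> 0 <= t <= 1 ->
  0 < (1 - t) * a + t * b.
Proof.
move=> a0 b0 /andP[t0 t1].
have [t2|t2] := leP t 2^-1; first by have := mulr_ge0 t0 (ltW b0); nra.
have : 0 <= (1 - t) * a by rewrite mulr_ge0 ?subr_ge0 // ltW.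
by nra.
Qed.

(** In a small disc around [z] the curve stays on the line of edge [k]. The half disc with an
    exterior point is convex and misses the curve, so it is all exterior; the sign of [c] records
    which half it is. *)
Lemma one_sided k z : open_edge k z -> closure ext z ->
  exists2 c : R, c != 0 & \forall y \near z,
    0 < c * cross (p k) (p (ordS k)) y -> ext y.
Proof.
move=> kz clz.
have n1 : \forall y \near z, curve y -> edge k y.
  have := @curve_near _ _ p z (pred1 k) _.
  have h j : edge j z -> pred1 k j by move=> /(open_edge_uniq p_simple kz) ->; exact: eqxx.
  by move=> /(_ h); apply: filterS => y hy /hy[j /eqP ->].
have n2 := line_near (edge_neq p_simple k) kz.
have /nbhs_ballP[d /= d0 hd] : \forall y \near z, (curve y -> edge k y) /\
    (cross (p k) (p (ordS k)) y = 0 -> open_edge k y) by exact: filterI.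
have [y0 [y0E y0d]] := clz _ (nbhsx_ballx z d d0).
have [y0c1 y0c2] := hd _ y0d.
exists (cross (p k) (p (ordS k)) y0).
  apply/eqP => /y0c2 /open_closed_segment ky0.
  by move/exteriorP: y0E => [+ _]; apply; exists k.
apply/nbhs_ballP; exists d => //= y yd cy.
apply: (exterior_segment _ y0E) => x xy /=.
have [xc _] := hd _ (ball_segment y0d yd xy).
move=> /xc /edge_cross; move/closed_segmentP: xy => [t t01 ->].
rewrite cross_affine; set a := cross _ _ y0 in cy *; set b := cross _ _ y in cy *.
move=> ab0; have a2 : 0 < a * a.
  by rewrite -expr2 lt_neqAle sqr_ge0 eq_sym sqrf_eq0 andbT; apply/eqP => a0;
     move: cy; rewrite a0 mul0r ltxx.
have := convex_gt0 a2 cy t01.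
rewrite (_ : _ + _ = a * ((1 - t) * a + t * b)); last by ring.
by rewrite ab0 mulr0 ltxx.
Qed.

Lemma side_closure u v (c : R) (A : set 'rV[R]_2) y : u != v -> c != 0 ->
  (\forall y' \near y, 0 < c * cross u v y' -> A y') -> cross u v y = 0 ->
  closure A y.
Proof.
move=> uv c0 hA cy.
(* The normal of [uv] that points to the side where [c * cross u v] is positive. *)
pose nn : 'rV[R]_2 := c *: \row_i (if i == 0 then u 0 1 - v 0 1 else v 0 0 - u 0 0).
have [e e0 he] := near_ray hA nn.
apply: (closure_ray (d := nn) e0) => s s0 se; apply: he.
  by rewrite gtr0_norm // ltW.
have -> : cross u v (y + s *: nn) = cross u v y +
    s * c * ((v 0 0 - u 0 0) ^+ 2 + (v 0 1 - u 0 1) ^+ 2).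
  by rewrite /cross !mxE /=; ring.
rewrite cy add0r mulrA mulr_gt0 ?sqr_norm_gt0 // mulrCA mulr_gt0 //.
by rewrite lt_neqAle eq_sym mulf_eq0 negb_or c0 -expr2 sqr_ge0.
Qed.

(** Along an open edge, being a limit of exterior points is a closed condition, and an open one by
    [one_sided]; segments are connected. *)
Lemma closure_open_edge k z z' : open_edge k z -> closure ext z ->
  open_edge k z' -> closure ext z'.
Proof.
move=> kz clz kz'.
have kS : closed_segment z z' `<=` open_edge k.
  move=> x xzz'.
  by case: (subsegment_open (open_closed_segment kz) kz' xzz') => [->|].
suff E : closed_segment z z' `&` closure ext = closed_segment z z'.
  by have := closed_segment_r z z'; rewrite -E => -[].
apply: closed_segment_connected.
- by exists z; split => //; exact: closed_segment_l.
- exists [set y | open_edge k y -> closure ext y]°; first exact: open_interior.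
  apply/seteqP; split=> x [xz xcl]; split=> //; last first.
    by have := interior_subset xcl; apply; exact: kS.
  have [c c0 hc] := one_sided (kS _ xz) xcl.
  have := nbhs_interior hc; apply: filterS => y hy ky.
  apply: (side_closure (edge_neq p_simple k) c0 hy).
  by apply: edge_cross; exact: open_closed_segment.
- by exists (closure ext) => //; exact: closed_closure.
Qed.

Lemma closure_edge_left k z : open_edge k z -> closure ext z ->
  closure ext (p k).
Proof.
move=> kz clz; rewrite (iffLR (closure_id _) (@closed_closure _ ext)).
apply: (@closure_ray _ _ _ _ (p (ordS k) - p k) 1) => // s s0 s1.
apply: (closure_open_edge kz clz).
by apply/open_segmentP; exists s; rewrite ?s0.
Qed.

Lemma near_plane (P : set 'rV[R]_2) (q u v : 'rV[R]_2) : nbhs q P ->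
  exists2 e : R, 0 < e < 1 & forall s t, `|s| <= e -> `|t| <= e ->
    P (q + s *: u + t *: v).
Proof.
move=> /nbhs_ballP[d /= d0 dP].
set M := `|u| + `|v| + 1.
have M0 : 0 < M by rewrite ltr_wpDl // addr_ge0.
pose e := Num.min 2^-1 (d / 2 / M).
have e0 : 0 < e by rewrite lt_min invr_gt0 ltr0n !divr_gt0.
have eM : e * M <= d / 2 by rewrite -ler_pdivlMr // ge_min lexx orbT.
have e2 : e <= 2^-1 by rewrite ge_min lexx.
exists e; first by rewrite e0 /=; lra.
move=> s t se te; apply: dP.
rewrite mx_norm_ball /ball_ /= opprD opprD addrA addrA subrr add0r -opprD normrN.
apply: le_lt_trans (ler_normD _ _) _; rewrite !normrZ.
have h1 : `|s| * `|u| <= e * `|u| by rewrite ler_wpM2r.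
have h2 : `|t| * `|v| <= e * `|v| by rewrite ler_wpM2r.
by apply: (@le_lt_trans _ _ (e * M)); [rewrite /M|]; lra.
Qed.

(* From an edge the exterior is followed around the vertex q on its own side:
   straight inside the angle if that is the exterior side, and otherwise behind
   q through the point q - e (u + v). *)
Lemma closure_next_edge k z : open_edge k z -> closure ext z ->
  exists2 z', open_edge (ordS k) z' & closure ext z'.
Proof.
move=> kz clz; set q := p (ordS k).
set u := p k - q; set v := p (ordS (ordS k)) - q; set D := det2 u v.
have D0 : D != 0.
  have -> : D = cross q (p k) (p (ordS (ordS k))) by rewrite crossE.
  apply: p_general; first exact: (ordS_neq p_simple).
    by rewrite eq_sym (ordS2_neq p_simple).
  by rewrite eq_sym (ordS_neq p_simple).
have det_uv s t s' t' : det2 (s *: u + t *: v) (s' *: u + t' *: v) =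
    (s * t' - s' * t) * D by rewrite /D /det2 !mxE; ring.
have uvE s t s' t' : q + s *: u + t *: v = q + s' *: u + t' *: v ->
    s = s' /\ t = t'.
  rewrite -!addrA => /addrI E; split; apply: (mulIf D0).
    by have := det_uv s t 0 1; rewrite E det_uv; lra.
  by have := det_uv 1 0 s t; rewrite E det_uv; lra.
have n1 : \forall y \near q, curve y -> edge k y \/ edge (ordS k) y.
  have h j : edge j q -> j \in [:: k; ordS k].
    move=> /(vertex_edge p_simple)[<-|/ordS_inj <-]; first by rewrite !inE eqxx orbT.
    by rewrite !inE eqxx.
  apply: filterS (curve_near h) => y hy /hy[j].
  by rewrite !inE => /orP[]/eqP ->; [left|right].
have [e /andP[e0 e1] he] := near_plane u v n1.
(* In the coordinates along [u] and [v], the curve near [q] lies on the half axes [t = 0, 0 <= s]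
   and [s = 0, 0 <= t]; the last two hypotheses exclude them. *)
have off s t : `|s| <= e -> `|t| <= e -> t != 0 \/ s < 0 -> s != 0 \/ t < 0 ->
    ~ curve (q + s *: u + t *: v).
  move=> se te ht hs /(he _ _ se te)[]/closed_segmentP[r /andP[r0 r1] E].
    have /uvE[s1 t1] : q + s *: u + t *: v = q + (1 - r) *: u + 0 *: v.
      by rewrite E -/q /u; apply: vec2P; rewrite !mxE; ring.
    by case: ht => [/eqP//|]; lra.
  have /uvE[s1 t1] : q + s *: u + t *: v = q + 0 *: u + r *: v.
    by rewrite E -/q /v; apply: vec2P; rewrite !mxE; ring.
  by case: hs => [/eqP//|]; lra.
have ke : open_edge k (q + e *: u).
  apply/open_segmentP; exists (1 - e); first by lra.
  by rewrite /u; apply: vec2P; rewrite !mxE; ring.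
have [c c0 hc] := one_sided ke (closure_open_edge kz clz ke).
have crossuv s t : cross (p k) q (q + s *: u + t *: v) = - t * D.
  by rewrite crossE /D /u /v /det2 !mxE; ring.
(* The path runs straight from [q + e *: u] to [m] and straight on to [q + e *: v]; the sign
   condition makes it leave edge [k] on the exterior side. *)
have path ms mt : `|ms| <= e -> `|mt| <= e -> mt < e -> ms < e ->
    0 < c * (- mt * D) ->
    (forall r, 0 < r -> r <= 1 ->
       ~ curve (q + (e + r * (ms - e)) *: u + (r * mt) *: v) /\
       ~ curve (q + (r * ms) *: u + (e + r * (mt - e)) *: v)) ->
    closure ext (q + e *: v).
  move=> mse mte lmt lms cm offr; set m := q + ms *: u + mt *: v.
  have [r0 r01 hr] := near_ray_pos hc (m - (q + e *: u)).
  have zE r : q + e *: u + r *: (m - (q + e *: u)) =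
      q + (e + r * (ms - e)) *: u + (r * mt) *: v.
    by rewrite /m; apply: vec2P; rewrite !mxE; ring.
  have z'E r : q + e *: v + r *: (m - (q + e *: v)) =
      q + (r * ms) *: u + (e + r * (mt - e)) *: v.
    by rewrite /m; apply: vec2P; rewrite !mxE; ring.
  have extm : ext m.
    move: hr; rewrite zE crossuv => hr.
    have {}hr : ext (q + (e + r0 * (ms - e)) *: u + (r0 * mt) *: v).
      apply: hr; rewrite (_ : c * _ = r0 * (c * (- mt * D))); last by ring.
      by rewrite mulr_gt0 //; case/andP: r01.
    apply: (exterior_segment _ hr) => y /closed_segmentP[t t01 ->].
    have -> : m = q + e *: u + 1 *: (m - (q + e *: u)).
      by apply: vec2P; rewrite !mxE; ring.
    rewrite -zE.
    have -> : q + e *: u + r0 *: (m - (q + e *: u)) +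
      t *: (q + e *: u + 1 *: (m - (q + e *: u)) -
        (q + e *: u + r0 *: (m - (q + e *: u)))) =
      q + e *: u + (r0 + t * (1 - r0)) *: (m - (q + e *: u)).
      by apply: vec2P; rewrite !mxE; ring.
    rewrite zE; apply: (proj1 (offr _ _ _)); nra.
  apply: (@closure_ray _ _ _ _ (m - (q + e *: v)) 1) => // r rgt0 r1.
  apply: (exterior_segment _ extm) => y /closed_segmentP[t t01 ->].
  have -> : m + t *: (q + e *: v + r *: (m - (q + e *: v)) - m) =
      q + e *: v + (1 - t * (1 - r)) *: (m - (q + e *: v)).
    by apply: vec2P; rewrite !mxE; ring.
  by rewrite z'E; apply: (proj2 (offr _ _ _)); nra.
exists (q + e *: v).
  by apply/open_segmentP; exists e; rewrite ?e0.
have en : `|e| = e by rewrite gtr0_norm.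
have [cD|cD] : c * - D > 0 \/ c * - D < 0.
  have : c * - D != 0 by rewrite mulf_neq0 ?oppr_eq0.
  by rewrite neq_lt => /orP[]; [right|left].
- apply: (path (e / 2) (e / 2)).
  + by rewrite ger0_norm; lra.
  + by rewrite ger0_norm; lra.
  + by lra.
  + by lra.
  + by rewrite (_ : c * _ = (e / 2) * (c * - D)); [rewrite mulr_gt0 //; lra|ring].
  + move=> r r0 r1; split; apply: off.
    * by rewrite ger0_norm; nra.
    * by rewrite ger0_norm; nra.
    * by left; rewrite gt_eqF //; nra.
    * by left; rewrite gt_eqF //; nra.
    * by rewrite ger0_norm; nra.
    * by rewrite ger0_norm; nra.
    * by left; rewrite gt_eqF //; nra.
    * by left; rewrite gt_eqF //; nra.
- apply: (path (- e) (- e)).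
  + by rewrite normrN en.
  + by rewrite normrN en.
  + by lra.
  + by lra.
  + by rewrite (_ : c * _ = e * - (c * - D)); [rewrite mulr_gt0 //; lra|ring].
  + move=> r r0 r1; split; apply: off.
    * by rewrite ler_norml; apply/andP; split; nra.
    * by rewrite ler_norml; apply/andP; split; nra.
    * by left; rewrite lt_eqF //; nra.
    * by right; nra.
    * by rewrite ler_norml; apply/andP; split; nra.
    * by rewrite ler_norml; apply/andP; split; nra.
    * by right; nra.
    * by left; rewrite lt_eqF //; nra.
Qed.

Lemma boundary_endpoints z k : open_edge k z ->
  forall e, e \in boundary_chain p -> e.1 != z /\ e.2 != z.
Proof.
by move=> kz e /boundary_chainP[i ->]; split; apply/eqP => /= E;
   move: kz; rewrite -E; exact: open_edge_vertex.
Qed.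

(** A far point on a generic line through the midpoint of an edge is exterior, and the first edge
    met on the way to that midpoint borders the exterior. *)
Lemma closure_first_edge : exists k z, open_edge k z /\ closure ext z.
Proof.
have [n2 _ _] := p_simple; pose k0 : 'I_n := Ordinal (ltnW (ltnW n2)).
set z := p k0 + 2^-1 *: (p (ordS k0) - p k0).
have kz : open_edge k0 z := open_segment_mid _ _.
have [w _ gw] := generic_exists (w := 0) (boundary_endpoints kz) openT I.
have w0 : w != 0.
  have /gw[+ _] : (p k0, p (ordS k0)) \in boundary_chain p.
    by apply/boundary_chainP; exists k0.
  by apply: contra => /eqP ->; rewrite /det2 !mxE !mul0r mulr0 subr0.
have wn : 0 < `|w| by rewrite normr_gt0.
have [B B0 hB] := @curve_bounded _ _ p.
pose M := (B + `|z| + 1) / `|w|.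
have M0 : 0 <= M by rewrite divr_ge0 // !addr_ge0.
pose x := z - M *: w.
have extx : ext x.
  apply: (@exterior_ray _ _ _ _ (- w)); first by rewrite oppr_eq0.
  move=> s s0 /hB; apply/negP; rewrite -ltNge.
  have -> : x + s *: - w = z - (M + s) *: w.
    by rewrite /x; apply: vec2P; rewrite !mxE; ring.
  have : `|(M + s) *: w| <= `|z - (M + s) *: w| + `|z|.
    have := ler_normB (z - (M + s) *: w) z.
    by rewrite addrAC subrr add0r normrN.
  rewrite normrZ ger0_norm ?addr_ge0 // mulrDl /M divfK ?gt_eqF // => h.
  have : 0 <= s * `|w| by rewrite mulr_ge0.
  by lra.
have [ncx _] := iffLR (@exteriorP _ _ _ _) extx.
have gx : generic (boundary_chain p) x w.
  move=> e /gw; have E y : det2 w (y - x) = det2 w (y - z).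
    by rewrite /x /det2 !mxE; ring.
  by rewrite !E.
have [miss|[e [s [/boundary_chainP[k ->] s0 ks offs]]]] :=
    first_hit (iffRL (off_boundary _ _) ncx) gx.
  have /off_boundary := miss M M0; rewrite /x subrK => h.
  by case: h; exists k0 => //; exact: open_closed_segment.
exists k, (x + s *: w); split => //.
apply: (@closure_ray _ _ _ _ (- w) s) => // r r0 rs.
have -> : x + s *: w + r *: - w = x + (s - r) *: w.
  by apply: vec2P; rewrite !mxE; ring.
apply: (exterior_segment _ extx) => y /closed_segmentP[t /andP[t0 t1] ->].
rewrite (_ : x + t *: (x + (s - r) *: w - x) = x + (t * (s - r)) *: w); last first.
  by apply: vec2P; rewrite !mxE; ring.
by apply/off_boundary; apply: offs; nra.
Qed.

Lemma closure_exterior_open_edge k z : open_edge k z -> closure ext z.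
Proof.
suff : exists2 z', open_edge k z' & closure ext z'.
  by move=> [z' kz' clz'] kz; exact: (closure_open_edge kz' clz').
have [k0 [z0 [kz0 clz0]]] := closure_first_edge.
apply: (@ordS_ind n (fun k => exists2 z', open_edge k z' & closure ext z') k0).
  by move=> i [z' iz' clz']; exact: closure_next_edge iz' clz'.
by exists z0.
Qed.

Lemma closure_exterior_vertex k : closure ext (p k).
Proof.
have kz := open_segment_mid (p k) (p (ordS k)).
exact: (closure_edge_left kz (closure_exterior_open_edge kz)).
Qed.

Lemma exterior_even x : ext x -> parity (boundary_chain p) x = false.
Proof.
move=> /exteriorP[ncx ubx].
have [B B0 hB] := @curve_bounded _ _ p.
have [y cy By] : exists2 y, connected_component (~` curve) x y & B < `|y|.
  apply: contrapT => h; apply: ubx; exists B; split; first exact: num_real.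
  move=> M BM y cy /=; apply: le_trans (ltW BM).
  by rewrite leNgt; apply/negP => By; apply: h; exists y.
have cl := @boundary_closed _ _ p.
rewrite (parity_connected cl (@component_connected _ (~` curve) x) _
  (connected_component_refl ncx) cy); last first.
  by move=> z /connected_component_sub /off_boundary.
have ncy : ~ curve y := connected_component_sub cy.
have offy := iffRL (off_boundary _ _) ncy.
have y0 : 0 < `|y| by exact: le_lt_trans By.
(* A direction closer to [y] than the norm of [y] gives a ray on which the norm never drops below
   that of [y], so it misses the curve. *)
have [w wy gw] := generic_exists (off_chain_endpoints offy)
  (ball_open (y : 'rV[R]_2) `|y|) (ballxx (y : 'rV[R]_2) y0).
rewrite (crossings_parity cl offy gw); apply: miss_crossings => // s s0.
apply/off_boundary => /hB; apply/negP; rewrite -ltNge; apply: lt_le_trans By _.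
move: wy; rewrite mx_norm_ball /ball_ /= => wy.
have : `|(1 + s) *: y| <= `|y + s *: w| + s * `|y - w|.
  rewrite -[s * _](_ : `|s *: (y - w)| = _); last by rewrite normrZ ger0_norm.
  rewrite (_ : (1 + s) *: y = y + s *: w + s *: (y - w)); first exact: ler_normD.
  by apply: vec2P; rewrite !mxE; ring.
rewrite normrZ ger0_norm ?addr_ge0 // => h.
have : s * `|y - w| <= s * `|y| by rewrite ler_wpM2l // ltW.
by lra.
Qed.

(** Brings edge [k] to the head of the chain, the form that [parity_flip] requires. *)
Lemma boundary_split k : exists ch,
  perm_eq (boundary_chain p) ((p k, p (ordS k)) :: ch) /\
  forall e, e \in ch -> exists2 j, j != k & e = (p j, p (ordS j)).
Proof.
exists [seq (p i, p (ordS i)) | i <- rem k (enum 'I_n)]; split.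
  rewrite -(map_cons (fun i => (p i, p (ordS i)))); apply: perm_map.
  by apply: perm_to_rem; rewrite mem_enum.
move=> e /mapP[j]; rewrite mem_rem_uniq ?enum_uniq // inE => /andP[jk _] ->.
by exists j.
Qed.

Lemma perm_parity (ch ch' : seq ('rV[R]_2 * 'rV[R]_2)) x : perm_eq ch ch' ->
  parity ch x = parity ch' x.
Proof.
move=> pe; have gE : generic ch x = generic ch' x.
  by apply/funext => w; apply/propext; split => h e; [rewrite -(perm_mem pe)|
     rewrite (perm_mem pe)]; exact: h.
by rewrite /parity /crossings gE (perm_big _ pe).
Qed.

(** Follow a generic ray from [x] to the first edge hit. This edge borders the exterior on one side.
    If that were the far side, it would be even, the near side odd by [parity_flip], and [x] odd; so
    it is the near side, which a segment off the curve joins to [x]. *)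
Lemma even_exterior x : ~ curve x -> parity (boundary_chain p) x = false ->
  ext x.
Proof.
move=> ncx ev; have cl := @boundary_closed _ _ p.
have offx := iffRL (off_boundary _ _) ncx.
have [w _ gw] := generic_exists (w := 0) (off_chain_endpoints offx) openT I.
have [n2 _ _] := p_simple; pose k0 : 'I_n := Ordinal (ltnW (ltnW n2)).
have w0 : w != 0.
  have /gw[+ _] : (p k0, p (ordS k0)) \in boundary_chain p.
    by apply/boundary_chainP; exists k0.
  by apply: contra => /eqP ->; rewrite /det2 !mxE !mul0r mulr0 subr0.
have [miss|[e [s [/boundary_chainP[k ->] s0 ks offs]]]] := first_hit offx gw.
  by apply: (exterior_ray w0) => s /miss /off_boundary.
set z := x + s *: w in ks.
have [c c0 hc] := one_sided ks (closure_exterior_open_edge ks).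
have [ch [pe chP]] := boundary_split k.
have gz : generic ((p k, p (ordS k)) :: ch) z w.
  move=> f; rewrite -(perm_mem pe) => /gw.
  have E y : det2 w (y - x) = det2 w (y - z) by rewrite /z /det2 !mxE; ring.
  by rewrite !E.
have offz : off_chain ch z.
  move=> f /chP[j jk ->] jz; move/eqP: jk; apply.
  exact: open_edge_uniq jz.
have cl' : closed_chain ((p k, p (ordS k)) :: ch).
  by move=> g; rewrite -(perm_big _ pe).
have [d d0 hd] := parity_flip cl' offz ks gz.
have [d' d0' hd'] := near_ray hc w.
set r := Num.min s (Num.min d d').
have r0 : 0 < r by rewrite !lt_min s0 d0.
have rs : r <= s by rewrite ge_min lexx.
have rd : r <= d by rewrite !ge_min lexx orbT.
have rd' : r <= d' by rewrite !ge_min lexx !orbT.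
have [_ _] := hd r r0 rd; rewrite -!(perm_parity _ pe) => flip.
have seg t : 0 <= t -> t < s -> closed_segment x (x + t *: w) `<=` ~` curve.
  move=> t0 ts y /closed_segmentP[q q01 ->].
  rewrite (_ : x + q *: (x + t *: w - x) = x + (q * t) *: w); last first.
    by apply: vec2P; rewrite !mxE; ring.
  by apply/off_boundary; apply: offs; nra.
have zr : z - r *: w = x + (s - r) *: w.
  by rewrite /z; apply: vec2P; rewrite !mxE; ring.
have segr : closed_segment x (z - r *: w) `<=` ~` curve.
  by rewrite zr; apply: seg; lra.
have crossz t : cross (p k) (p (ordS k)) (z + t *: w) =
    t * det2 (p (ordS k) - p k) w.
  move: (edge_cross (open_closed_segment ks)); rewrite !crossE => h.
  by rewrite -[RHS]add0r -h /det2 !mxE; ring.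
have D0 : det2 (p (ordS k) - p k) w != 0.
  move/open_segmentP: ks => [q /andP[q0 _] zE].
  have [+ _] := gz _ (mem_head _ _).
  rewrite zE /= (_ : det2 w _ = q * det2 (p (ordS k) - p k) w).
    by rewrite mulf_eq0 negb_or => /andP[].
  by rewrite /det2 !mxE; ring.
have [cD|cD] : 0 < c * det2 (p (ordS k) - p k) w \/
               c * det2 (p (ordS k) - p k) w < 0.
  have : c * det2 (p (ordS k) - p k) w != 0 by rewrite mulf_neq0.
  by rewrite neq_lt => /orP[]; [right|left].
- have /exterior_even : ext (z + r *: w).
    apply: hd'; first by rewrite gtr0_norm.
    by rewrite crossz mulrCA mulr_gt0.
  rewrite flip -(parity_segment cl (x := x)) ?ev //.
  by move=> y /segr /off_boundary.
- apply: (exterior_segment (x := z - r *: w)).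
    by rewrite closed_segmentC.
  rewrite -scaleNr; apply: hd'; first by rewrite normrN gtr0_norm.
  by rewrite crossz mulrCA mulNr oppr_gt0 pmulr_rlt0.
Qed.

Lemma interior_odd x : polygon_interior p x -> parity (boundary_chain p) x.
Proof.
move=> xi; apply/negPn/negP => /negbTE /even_exterior.
have [nc _] := xi.
by move=> /(_ nc); apply; right.
Qed.

End Jordan.

(** * Interleaved diagonals *)

Section Chords.
Context {R : realType} {n : nat}.
Variable p : 'I_n -> 'rV[R]_2.
Hypothesis p_simple : simple_polygon p.
Hypothesis p_general : general_position p.
Implicit Types (i j k m x y : 'I_n) (z w : 'rV[R]_2).

Local Notation curve := (polygon_curve p).
Local Notation edge := (polygon_edge p).
Local Notation open_edge k := (open_segment (p k) (p (ordS k))).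
Local Notation "x %+ r" := (iter r (@ordS n) x) (at level 40).

Definition arc x (l : nat) : seq ('rV[R]_2 * 'rV[R]_2) :=
  [seq (p (x %+ r), p (ordS (x %+ r))) | r <- iota 0 l].

Lemma arcP x l e : e \in arc x l <->
  exists2 r, (r < l)%N & e = (p (x %+ r), p (ordS (x %+ r))).
Proof.
split=> [/mapP[r]|[r rl ->]]; first by rewrite mem_iota => /andP[_ rl] ->; exists r.
by apply/mapP; exists r => //; rewrite mem_iota.
Qed.

Lemma arc_sum (g : 'rV[R]_2 -> bool) x l :
  \big[addb/false]_(e <- arc x l) (g e.1 (+) g e.2) = g (p x) (+) g (p (x %+ l)).
Proof.
elim: l => [|l IH]; first by rewrite /arc big_nil addbb.
rewrite /arc -[l.+1]addn1 iotaD map_cat big_cat -/(arc x l) IH /= big_cons big_nil.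
by rewrite addbF addn1 /=; do 3 case: (g _).
Qed.

Lemma arc_cat x l l' : arc x (l + l') = arc x l ++ arc (x %+ l) l'.
Proof.
rewrite /arc iotaD map_cat; congr (_ ++ _).
rewrite add0n -[l in iota l]addn0 iotaDl -map_comp; apply: eq_map => r /=.
by rewrite addnC iterD.
Qed.

Lemma iter_ordS_inj x r r' : (r < n)%N -> (r' < n)%N -> x %+ r = x %+ r' -> r = r'.
Proof.
move=> rn rn' /(congr1 val) /=; rewrite !val_iter_ordS => /eqP.
by rewrite eqn_modDl !modn_small // => /eqP.
Qed.

Lemma iter_ordS_n x : x %+ n = x.
Proof. by apply: ord_inj; rewrite val_iter_ordS modnDr modn_small. Qed.

Lemma iter_ordS_ex x i : exists2 r, (r < n)%N & i = x %+ r.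
Proof.
have n0 : (0 < n)%N by apply: leq_ltn_trans (ltn_ord x).
exists ((n - x + i) %% n)%N; first by rewrite ltn_mod.
apply: ord_inj; rewrite val_iter_ordS modnDmr addnA subnKC; last exact: ltnW.
by rewrite modnDl modn_small.
Qed.

Lemma arc_full x : perm_eq (boundary_chain p) (arc x n).
Proof.
rewrite /arc (map_comp (fun i => (p i, p (ordS i))) (fun r => x %+ r)).
apply: perm_map; apply: uniq_perm; first exact: enum_uniq.
  rewrite map_inj_in_uniq ?iota_uniq // => r r'; rewrite !mem_iota /= => rn rn'.
  exact: iter_ordS_inj.
move=> i; rewrite mem_enum; apply/esym/mapP.
by have [r rn ->] := iter_ordS_ex x i; exists r => //; rewrite mem_iota.
Qed.

Lemma off_arc x l z : ~ curve z -> off_chain (arc x l) z.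
Proof. by move=> nz e /arcP[r _ ->] ez; apply: nz; exists (x %+ r). Qed.

(** An arc without its two end vertices is connected, and it avoids [ch] by hypothesis. *)
Lemma arc_parity ch x l : closed_chain ch ->
  (forall r, (0 < r)%N -> (r < l)%N -> off_chain ch (p (x %+ r))) ->
  (forall r z, (r < l)%N -> open_edge (x %+ r) z -> off_chain ch z) ->
  forall r r' z, (r < l)%N -> (0 < r' < l)%N -> open_edge (x %+ r) z ->
    parity ch z = parity ch (p (x %+ r')).
Proof.
move=> cl Hv Ho r r' z rl /andP[r'0 r'l] rz.
have edgeOff q : (0 < q)%N -> (q.+1 < l)%N ->
    closed_segment (p (x %+ q)) (p (x %+ q.+1)) `<=` off_chain ch.
  move=> q0 ql y /closed_segment_cases[->|->|].
  - by apply: Hv => //; exact: ltnW.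
  - exact: Hv.
  - by apply: Ho; exact: ltnW.
have vert q : (0 < q)%N -> (q < l)%N ->
    parity ch (p (x %+ q)) = parity ch (p (x %+ 1)).
  elim: q => // -[//|q] IH _ ql; rewrite -IH //; last exact: ltnW.
  by apply/esym/parity_segment => //; exact: edgeOff.
rewrite (vert r') //; have [r0|r0] := posnP r.
  have l1 : (1 < l)%N by apply: leq_ltn_trans r'l.
  subst r; apply: parity_segment => //; rewrite closed_segmentC => y.
  have h := closed_segment_r (p x) (p (ordS x)).
  move=> /(subsegment_open h rz)[->|]; first exact: (Hv 1).
  exact: (Ho 0).
rewrite -(vert r) //; apply: parity_segment => //; rewrite closed_segmentC => y.
have h := closed_segment_l (p (x %+ r)) (p (ordS (x %+ r))).
move=> /(subsegment_open h rz)[->|]; first exact: Hv.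
exact: Ho.
Qed.

Section Arcs.
Variables (x y : 'I_n) (l l' : nat).
Hypotheses (ll' : (l + l' = n)%N) (yE : y = x %+ l).

Lemma arc_vertex_off r : (0 < r < l)%N -> off_chain (arc y l') (p (x %+ r)).
Proof.
move=> /andP[r0 rl] e /arcP[q ql ->] /= /(vertex_edge p_simple).
have rn : (r < n)%N by rewrite -ll' ltn_addr.
have qn : (q + l < n)%N by rewrite -ll' addnC ltn_add2l.
rewrite yE -iterS -!iterD addSn => -[/iter_ordS_inj|E].
  by move=> /(_ rn qn) E; move: rl; rewrite E ltnNge leq_addl.
move: qn; rewrite leq_eqVlt => /predU1P[qn|qn].
  have /iter_ordS_inj : x %+ r = x %+ 0 by rewrite E qn iter_ordS_n.
  by move=> /(_ rn (leq_ltn_trans (leq0n _) rn)) r00; rewrite r00 in r0.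
by move: (iter_ordS_inj rn qn E) rl => ->; rewrite ltnNge -addSn leq_addl.
Qed.

Lemma arc_edge_off r z : (r < l)%N -> open_edge (x %+ r) z ->
  off_chain (arc y l') z.
Proof.
move=> rl rz e /arcP[q ql ->] /= /(open_edge_uniq p_simple rz).
rewrite yE -iterD => /iter_ordS_inj E.
have rn : (r < n)%N by rewrite -ll' ltn_addr.
have qn : (q + l < n)%N by rewrite -ll' addnC ltn_add2l.
by move: rl; rewrite -(E qn rn) ltnNge leq_addl.
Qed.

End Arcs.

(* The chord ab cuts the boundary into two closed chains Q1 and Q2 with
   parity P = parity Q1 + parity Q2. If cd avoids ab, the interior parts of the
   arcs have parities x2 w.r.t. Q1 and y1 w.r.t. Q2 with x2 + y1 = 1; but
   one side of ab has the opposite pair of parities, and a ray leaving ab on that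
   side can hit neither arc. *)
Lemma interleaved_chords_meet (a b c d : 'I_n) : (a < c < b)%N -> (b < d)%N ->
  is_diagonal p (a, b) -> is_diagonal p (c, d) ->
  open_segment (p a) (p b) `&` open_segment (p c) (p d) !=set0.
Proof.
move=> /andP[ac cb] bd diab dicd.
apply: contrapT => /set0P/negP/negPn/eqP dis.
have [_ inj _] := p_simple.
have nc (u v : 'I_n) z : is_diagonal p (u, v) -> open_segment (p u) (p v) z ->
  ~ curve z by move=> h /h[].
have vcurve m : curve (p m) by exists m => //; exact: closed_segment_l.
pose l1 := (b - a)%N; pose l2 := (n - l1)%N.
have ab : (a < b)%N := ltn_trans ac cb.
have l1n : (l1 < n)%N by exact: leq_ltn_trans (leq_subr _ _) (ltn_ord b).
have l10 : (0 < l1)%N by rewrite subn_gt0.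
have l20 : (0 < l2)%N by rewrite subn_gt0.
have l12 : (l1 + l2 = n)%N by rewrite subnKC // ltnW.
have l21 : (l2 + l1 = n)%N by rewrite addnC.
have bE : b = a %+ l1.
  by apply: ord_inj; rewrite val_iter_ordS subnKC ?modn_small // ltnW.
have aE : a = b %+ l2 by rewrite bE -iterD l21 iter_ordS_n.
have cE : c = a %+ (c - a).
  by apply: ord_inj; rewrite val_iter_ordS subnKC ?modn_small // ltnW.
have dE : d = b %+ (d - b).
  by apply: ord_inj; rewrite val_iter_ordS subnKC ?modn_small // ltnW.
have cr : (0 < c - a < l1)%N by rewrite subn_gt0 ac ltn_sub2r.
have dr : (0 < d - b < l2)%N.
  rewrite subn_gt0 bd /l2 /l1 subnBA; last exact: ltnW.
  by rewrite ltn_sub2r // ?ltn_addr // (leq_trans (ltn_ord b)) // leq_addr.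
set e0 := (p a, p b).
have off0 z : (forall m, z <> p m) -> ~ open_segment (p a) (p b) z ->
    ~ closed_segment e0.1 e0.2 z.
  by move=> zm zo /closed_segment_cases[/zm|/zm|].
pose Q1 := e0 :: arc a l1; pose Q2 := e0 :: arc b l2.
have cl := @boundary_closed _ _ p.
have cl1 : closed_chain Q1.
  by move=> g; rewrite big_cons arc_sum -bE /= addbb.
have cl2 : closed_chain Q2.
  by move=> g; rewrite big_cons arc_sum -aE /=; do 2 case: (g _).
have offQ e ch z : off_chain ch z -> ~ closed_segment e.1 e.2 z ->
    off_chain (e :: ch) z.
  by move=> h h' f; rewrite inE => /predU1P[->//|/h].
have curve_off0 z : curve z -> (forall m, z <> p m) -> ~ closed_segment e0.1 e0.2 z.
  by move=> cz zm; apply: off0 => // /(nc _ _ _ diab).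
have vertex_off0 m : m <> a -> m <> b -> ~ closed_segment e0.1 e0.2 (p m).
  move=> ma mb /closed_segment_cases[/inj//|/inj//|].
  by move=> /(nc _ _ _ diab); apply.
have open_off0 k z : open_edge k z -> ~ closed_segment e0.1 e0.2 z.
  move=> kz; apply: curve_off0.
    by exists k => //; exact: open_closed_segment.
  by move=> m E; move: kz; rewrite E; exact: open_edge_vertex.
have ordn k r r' : (r < n)%N -> (r' < n)%N -> r <> r' -> k %+ r <> k %+ r'.
  by move=> rn rn' rr' /(iter_ordS_inj rn rn').
have v1 r : (0 < r)%N -> (r < l1)%N -> off_chain Q2 (p (a %+ r)).
  move=> r0 rl; apply: offQ; first by apply: (arc_vertex_off l12 bE); rewrite r0.
  have rn := ltn_trans rl l1n.
  apply: vertex_off0.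
    by apply: (ordn _ _ 0%N) => // [|E]; [exact: leq_ltn_trans rn|rewrite E in r0].
  by rewrite [X in _ <> X]bE; apply: ordn => // E; rewrite E ltnn in rl.
have v2 r : (0 < r)%N -> (r < l2)%N -> off_chain Q1 (p (b %+ r)).
  move=> r0 rl; apply: offQ; first by apply: (arc_vertex_off l21 aE); rewrite r0.
  have l2n : (l2 < n)%N by rewrite -l21 -addn1 leq_add2l.
  have rn := ltn_trans rl l2n.
  apply: vertex_off0; last first.
    by apply: (ordn _ _ 0%N) => // [|E]; [exact: leq_ltn_trans rn|rewrite E in r0].
  by rewrite [X in _ <> X]aE; apply: ordn => // E; rewrite E ltnn in rl.
have o1 r z : (r < l1)%N -> open_edge (a %+ r) z -> off_chain Q2 z.
  move=> rl rz; apply: offQ; first exact: (arc_edge_off l12 bE rl).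
  exact: open_off0 rz.
have o2 r z : (r < l2)%N -> open_edge (b %+ r) z -> off_chain Q1 z.
  move=> rl rz; apply: offQ; first exact: (arc_edge_off l21 aE rl).
  exact: open_off0 rz.
have par1 r z rl rz := @arc_parity Q2 a l1 cl2 v1 o1 r (c - a)%N z rl cr rz.
have par2 r z rl rz := @arc_parity Q1 b l2 cl1 v2 o2 r (d - b)%N z rl dr rz.
rewrite -cE in par1; rewrite -dE in par2.
have pP : perm_eq (boundary_chain p) (arc a l1 ++ arc b l2).
  by rewrite bE -arc_cat l12; exact: arc_full.
(* The chord occurs in both chains and cancels modulo 2. Taking [w] generic for the chord and the
   whole boundary lets one direction compute all three parities. *)
have padd z : ~ curve z -> ~ closed_segment e0.1 e0.2 z ->
    parity (boundary_chain p) z = parity Q1 z (+) parity Q2 z.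
  move=> cz ez; have offz := iffRL (off_boundary _ _) cz.
  have offz' : off_chain (e0 :: boundary_chain p) z by exact: offQ.
  have [w _ gw] := generic_exists (w := 0) (off_chain_endpoints offz') openT I.
  have sub ch : {subset ch <= e0 :: boundary_chain p} -> generic ch z w.
    by move=> h f /h; exact: gw.
  rewrite (crossings_parity cl offz (w := w)); last first.
    by apply: sub => f fb; rewrite inE fb orbT.
  have sub' f : f \in arc a l1 ++ arc b l2 -> f \in e0 :: boundary_chain p.
    by rewrite -(perm_mem pP) inE => ->; rewrite orbT.
  rewrite (crossings_parity cl1 (w := w)); last 2 first.
  - by apply: offQ => //; exact: off_arc.
  - apply: sub => f; rewrite inE => /predU1P[->|fb]; first exact: mem_head.
    by apply: sub'; rewrite mem_cat fb.
  rewrite (crossings_parity cl2 (w := w)); last 2 first.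
  - by apply: offQ => //; exact: off_arc.
  - apply: sub => f; rewrite inE => /predU1P[->|fb]; first exact: mem_head.
    by apply: sub'; rewrite mem_cat fb orbT.
  rewrite /crossings (perm_big _ pP) /= big_cat /= !big_cons.
  by case: (ray_hits _ _ _ _); do 2 case: (\big[_/_]_(_ <- _) _).
have cd_off z : open_segment (p c) (p d) z -> ~ closed_segment e0.1 e0.2 z.
  move=> cdz; apply: off0 => [m E|abz]; last first.
    suff : set0 z by []. by rewrite -dis.
  by move: (nc _ _ _ dicd cdz); rewrite E; apply.
set mm := p c + 2^-1 *: (p d - p c).
have cdm : open_segment (p c) (p d) mm := open_segment_mid _ _.
have q2c : parity Q2 mm = parity Q2 (p c).
  apply/esym/parity_segment => // z.
  have h := closed_segment_l (p c) (p d).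
  move=> /(subsegment_open h cdm)[->|cdz].
    by case/andP: cr => c0 c1; rewrite cE; exact: v1.
  by apply: offQ; [exact/off_arc/(nc _ _ _ dicd)|exact: cd_off].
have q1d : parity Q1 mm = parity Q1 (p d).
  apply/esym/parity_segment => // z.
  have h := closed_segment_r (p c) (p d).
  move=> /(subsegment_open h cdm)[->|cdz].
    by case/andP: dr => d0 d1; rewrite dE; exact: v2.
  by apply: offQ; [exact/off_arc/(nc _ _ _ dicd)|exact: cd_off].
have odd : parity Q1 (p d) (+) parity Q2 (p c).
  rewrite -q1d -q2c -padd; [|exact: (nc _ _ _ dicd)|exact: cd_off].
  by apply: interior_odd => //; exact: dicd.
set z0 := p a + 2^-1 *: (p b - p a).
have abz0 : open_segment (p a) (p b) z0 := open_segment_mid _ _.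
have ncz0 := nc _ _ _ diab abz0.
(* As [y] is odd, its ray hits the curve. Before the first hit it stays off the curve and the chord,
   so a hit on the arc from [a] to [b] carries the [Q2] parity of that arc back to [y], and a hit on
   the other arc carries its [Q1] parity back; both are excluded. *)
have bad w (r : R) : generic (e0 :: boundary_chain p) z0 w -> 0 < r ->
    ~ curve (z0 + r *: w) -> parity (boundary_chain p) (z0 + r *: w) ->
    parity Q1 (z0 + r *: w) = ~~ parity Q1 (p d) ->
    parity Q2 (z0 + r *: w) = ~~ parity Q2 (p c) -> False.
  move=> gw r0; set y := z0 + r *: w => ncy py q1y q2y.
  have yE s : y + s *: w = z0 + (r + s) *: w by rewrite /y scalerDl addrA.
  have off0y s : 0 <= s -> ~ closed_segment e0.1 e0.2 (y + s *: w).
    move=> s0; rewrite yE; have [g1 g2] := gw _ (mem_head _ _).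
    have h : closed_segment e0.1 e0.2 (z0 + 0 *: w).
      by rewrite scale0r addr0; exact: open_closed_segment.
    by move=> /(line_hit g1 g2 h); lra.
  have gy : generic (boundary_chain p) y w.
    move=> f fb; have := gw f; rewrite inE fb orbT => /(_ isT).
    have E v : det2 w (v - y) = det2 w (v - z0) by rewrite /y /det2 !mxE; ring.
    by rewrite !E.
  have offy := iffRL (off_boundary _ _) ncy.
  have [miss|[e [s [/boundary_chainP[k ->] s0 ks offs]]]] := first_hit offy gy.
    by move: py; rewrite (crossings_parity cl offy gy) miss_crossings.
  have ray ch : off_chain ch (y + s *: w) ->
      (forall z, ~ curve z -> ~ closed_segment e0.1 e0.2 z -> off_chain ch z) ->
      closed_segment y (y + s *: w) `<=` off_chain ch.
    move=> hs hch z /closed_segmentP[t /andP[t0 t1] ->].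
    rewrite (_ : y + _ = y + (t * s) *: w); last first.
      by apply: vec2P; rewrite !mxE; ring.
    move: t1; rewrite le_eqVlt => /predU1P[->|t1]; first by rewrite mul1r.
    have ts0 : 0 <= t * s by rewrite mulr_ge0 // ltW.
    apply: hch; last exact: off0y.
    by apply/off_boundary; apply: offs => //; rewrite -[ltRHS]mul1r ltr_pM2r.
  have [q qn kE] := iter_ordS_ex a k; rewrite {}kE /= in ks.
  have [ql|ql] := ltnP q l1.
    have : parity Q2 y = parity Q2 (y + s *: w).
      apply: parity_segment => //; apply: ray; first exact: o1 ql ks.
      by move=> z cz ez; apply: offQ => //; exact: off_arc.
    by rewrite (par1 _ _ ql ks) q2y; case: (parity _ _).
  have qE : a %+ q = b %+ (q - l1) by rewrite bE -iterD subnK.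
  have ql2 : (q - l1 < l2)%N by rewrite ltn_sub2r.
  rewrite qE in ks.
  have : parity Q1 y = parity Q1 (y + s *: w).
    apply: parity_segment => //; apply: ray; first exact: o2 ql2 ks.
    by move=> z cz ez; apply: offQ => //; exact: off_arc.
  by rewrite (par2 _ _ ql2 ks) q1y; case: (parity _ _).
have ends e : e \in e0 :: boundary_chain p -> e.1 != z0 /\ e.2 != z0.
  have h m : p m != z0 by apply/eqP => E; apply: ncz0; rewrite -E.
  by rewrite inE => /predU1P[->|/boundary_chainP[i ->]]; split; exact: h.
have [w _ gw] := generic_exists (w := 0) ends openT I.
have sub' f : f \in arc a l1 ++ arc b l2 -> f \in e0 :: boundary_chain p.
  by rewrite -(perm_mem pP) inE => ->; rewrite orbT.
have g1 : generic Q1 z0 w.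
  move=> f; rewrite inE => /predU1P[->|fb]; first exact/gw/mem_head.
  by apply/gw/sub'; rewrite mem_cat fb.
have g2 : generic Q2 z0 w.
  move=> f; rewrite inE => /predU1P[->|fb]; first exact/gw/mem_head.
  by apply/gw/sub'; rewrite mem_cat fb orbT.
have [d1 d10 h1] := parity_flip cl1 (off_arc ncz0) abz0 g1.
have [d2 d20 h2] := parity_flip cl2 (off_arc ncz0) abz0 g2.
have offz0 := iffRL (off_boundary _ _) ncz0.
have [d3 d30 h3] := near_ray (parity_near cl offz0) w.
pose r := Num.min d1 (Num.min d2 d3).
have r0 : 0 < r by rewrite !lt_min d10 d20.
have r1 : r <= d1 by rewrite ge_min lexx.
have r2 : r <= d2 by rewrite !ge_min lexx orbT.
have r3 : r <= d3 by rewrite !ge_min lexx !orbT.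
have [off1 off1' f1] := h1 r r0 r1; have [_ _ f2] := h2 r r0 r2.
have pz0 : parity (boundary_chain p) z0 by apply: interior_odd => //; exact: diab.
have [/off_boundary ncp pp] : off_chain (boundary_chain p) (z0 + r *: w) /\
    parity (boundary_chain p) (z0 + r *: w) = parity (boundary_chain p) z0.
  by apply: h3; rewrite gtr0_norm.
have [/off_boundary ncm pm] : off_chain (boundary_chain p) (z0 - r *: w) /\
    parity (boundary_chain p) (z0 - r *: w) = parity (boundary_chain p) z0.
  by rewrite -scaleNr; apply: h3; rewrite normrN gtr0_norm.
have := padd _ ncp (off1 _ (mem_head _ _)).
rewrite pp pz0 => /esym q12.
have gw' : generic (e0 :: boundary_chain p) z0 (- w).
  have E v : det2 (- w) v = - det2 w v by rewrite /det2 !mxE; ring.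
  by move=> f /gw; rewrite !E !oppr_eq0.
have bp := bad w r gw r0 ncp; rewrite pp in bp.
have bm := bad (- w) r gw' r0; rewrite scalerN in bm.
have {}bm := bm ncm; rewrite pm in bm.
(* Both sides of [ab] are odd for the boundary and crossing [ab] flips both parities, so one of the
   two sides has the excluded pair. *)
move: bp bm odd q12; rewrite pz0 f1 f2.
by do 4 case: (parity _ _) => //=; do ?[move=> /(_ isT erefl erefl) []|move=> _].
Qed.

End Chords.

(** * Triangles and triangulations *)

Section Triangles.
Context {R : realType}.
Implicit Types a b c q v x y : 'rV[R]_2.

Definition tri v a b : set 'rV[R]_2 := [set x | exists s t : R,
  [/\ 0 <= s, 0 <= t, s + t <= 1 & x = v + s *: (a - v) + t *: (b - v)]].

Definition open_tri v a b : set 'rV[R]_2 := [set x | exists s t : R,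
  [/\ 0 < s, 0 < t, s + t < 1 & x = v + s *: (a - v) + t *: (b - v)]].

Lemma triCr v a b : tri v a b = tri v b a.
Proof.
by apply/seteqP; split=> x [s [t [s0 t0 st ->]]]; exists t, s;
   (split=> //; [rewrite addrC|rewrite addrAC]).
Qed.

Lemma triCl v a b : tri v a b = tri a v b.
Proof.
by apply/seteqP; split=> x [s [t [s0 t0 st ->]]]; exists (1 - s - t), t;
   (split; [lra|lra|lra|apply: vec2P; rewrite !mxE; ring]).
Qed.

Lemma open_triCr v a b : open_tri v a b = open_tri v b a.
Proof.
by apply/seteqP; split=> x [s [t [s0 t0 st ->]]]; exists t, s;
   (split=> //; [rewrite addrC|rewrite addrAC]).
Qed.

Lemma open_triCl v a b : open_tri v a b = open_tri a v b.
Proof.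
by apply/seteqP; split=> x [s [t [s0 t0 st ->]]]; exists (1 - s - t), t;
   (split; [lra|lra|lra|apply: vec2P; rewrite !mxE; ring]).
Qed.

Lemma triangle_areaCr v a b : triangle_area v a b = triangle_area v b a.
Proof.
rewrite /triangle_area (_ : cross v b a = - cross v a b) ?normrN //.
by rewrite /cross; ring.
Qed.

Lemma triangle_areaCl v a b : triangle_area v a b = triangle_area a v b.
Proof.
rewrite /triangle_area (_ : cross a v b = - cross v a b) ?normrN //.
by rewrite /cross; ring.
Qed.

(** Together with [coord2], the barycentric coordinates at [a] and [b], written by Cramer's rule
    with [v] as origin. *)
Definition coord1 v a b x : R := det2 (x - v) (b - v) / det2 (a - v) (b - v).
Definition coord2 v a b x : R := det2 (a - v) (x - v) / det2 (a - v) (b - v).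

Section Nondegenerate.
Variables v a b : 'rV[R]_2.
Hypothesis nd : det2 (a - v) (b - v) != 0.

Lemma coordE x :
  x = v + coord1 v a b x *: (a - v) + coord2 v a b x *: (b - v).
Proof.
apply: (addIr (- v)); apply: (scalerI nd).
rewrite det2_basis.
have -> : v + coord1 v a b x *: (a - v) + coord2 v a b x *: (b - v) - v =
    coord1 v a b x *: (a - v) + coord2 v a b x *: (b - v).
  by apply: vec2P; rewrite !mxE; ring.
by rewrite [RHS]scalerDr !scalerA /coord1 /coord2 ![det2 (a - v) (b - v) * _]mulrC !divfK.
Qed.

Lemma coord12 (s t : R) :
  coord1 v a b (v + s *: (a - v) + t *: (b - v)) = s /\
  coord2 v a b (v + s *: (a - v) + t *: (b - v)) = t.
Proof.
split; apply: (mulIf nd); rewrite /coord1 /coord2 divfK //.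
- by rewrite /det2 !mxE; ring.
- by rewrite /det2 !mxE; ring.
Qed.

Lemma triP x : tri v a b x <->
  [/\ 0 <= coord1 v a b x, 0 <= coord2 v a b x &
      coord1 v a b x + coord2 v a b x <= 1].
Proof.
split=> [[s [t [s0 t0 st ->]]]|[s0 t0 st]].
  by have [-> ->] := coord12 s t.
by exists (coord1 v a b x), (coord2 v a b x); split=> //; exact: coordE.
Qed.

Lemma open_triP x : open_tri v a b x <->
  [/\ 0 < coord1 v a b x, 0 < coord2 v a b x &
      coord1 v a b x + coord2 v a b x < 1].
Proof.
split=> [[s [t [s0 t0 st ->]]]|[s0 t0 st]].
  by have [-> ->] := coord12 s t.
by exists (coord1 v a b x), (coord2 v a b x); split=> //; exact: coordE.
Qed.

Lemma coord1_continuous : continuous (coord1 v a b).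
Proof.
set D := det2 (a - v) (b - v).
apply: (affine_continuous
  (c0 := (- v 0 0 * (b 0 1 - v 0 1) + (b 0 0 - v 0 0) * v 0 1) / D)
  (c1 := (b 0 1 - v 0 1) / D) (c2 := - (b 0 0 - v 0 0) / D)) => y.
rewrite /coord1 -/D; apply: (mulIf nd); rewrite -/D.
by rewrite {1}/det2 !mxE; field.
Qed.

Lemma coord2_continuous : continuous (coord2 v a b).
Proof.
set D := det2 (a - v) (b - v).
apply: (affine_continuous
  (c0 := - ((a 0 0 - v 0 0) * v 0 1 - v 0 0 * (a 0 1 - v 0 1)) / D)
  (c1 := - (a 0 1 - v 0 1) / D) (c2 := (a 0 0 - v 0 0) / D)) => y.
rewrite /coord2 -/D; apply: (mulIf nd); rewrite -/D.
by rewrite {1}/det2 !mxE; field.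
Qed.

Lemma coord3_continuous x :
  {for x, continuous (fun x => 1 - (coord1 v a b x + coord2 v a b x))}.
Proof.
have h : {for x, continuous (fun x => coord1 v a b x + coord2 v a b x)}.
  by apply: continuousD; [exact: coord1_continuous|exact: coord2_continuous].
by apply: continuousB; [exact: cst_continuous|exact: h].
Qed.

Lemma open_tri_near x : open_tri v a b x -> \forall y \near x, open_tri v a b y.
Proof.
move=> /open_triP[s0 t0 st].
have n1 := near_gt0 (@coord1_continuous x) s0.
have n2 := near_gt0 (@coord2_continuous x) t0.
have n3 : \forall y \near x, 0 < 1 - (coord1 v a b y + coord2 v a b y).
  apply: (@near_gt0 _ (fun y => 1 - (coord1 v a b y + coord2 v a b y))).
    exact: coord3_continuous.
  by rewrite subr_gt0.
apply: filterS3 n1 n2 n3 => y y1 y2; rewrite subr_gt0 => y3.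
exact/open_triP.
Qed.

Lemma tri_near x : ~ tri v a b x -> \forall y \near x, ~ tri v a b y.
Proof.
move=> xt.
have [h|[h|h]] : 0 < - coord1 v a b x \/ 0 < - coord2 v a b x \/
    0 < - (1 - (coord1 v a b x + coord2 v a b x)).
  apply: contrapT => h; apply: xt; apply/triP; split; rewrite leNgt;
    apply/negP => h'; apply: h.
  - by left; lra.
  - by right; left; lra.
  - by right; right; lra.
- have := near_gt0 (continuousN (@coord1_continuous x)) h.
  by apply: filterS => y; rewrite oppr_gt0 => hy /triP[]; lra.
- have := near_gt0 (continuousN (@coord2_continuous x)) h.
  by apply: filterS => y; rewrite oppr_gt0 => hy /triP[]; lra.
- have := near_gt0 (continuousN (@coord3_continuous x)) h.
  by apply: filterS => y; rewrite oppr_gt0 => hy /triP[]; lra.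
Qed.

End Nondegenerate.

Lemma open_tri_sub v a b : open_tri v a b `<=` tri v a b.
Proof. by move=> x [s [t [s0 t0 st ->]]]; exists s, t; split=> //; exact: ltW. Qed.

Lemma open_tri_nonempty v a b :
  open_tri v a b (v + 3^-1 *: (a - v) + 3^-1 *: (b - v)).
Proof. by exists 3^-1, 3^-1; split=> //; lra. Qed.

(** A small step towards the centroid enters the open triangle. *)
Lemma tri_dense v a b x (O : set 'rV[R]_2) : tri v a b x -> nbhs x O ->
  exists2 y, O y & open_tri v a b y.
Proof.
move=> [s [t [s0 t0 st xE]]] /near_ray_pos h.
have [e /andP[e0 e1] Oe] := h (v + 3^-1 *: (a - v) + 3^-1 *: (b - v) - x).
exists (x + e *: (v + 3^-1 *: (a - v) + 3^-1 *: (b - v) - x)) => //.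
exists ((1 - e) * s + e * 3^-1), ((1 - e) * t + e * 3^-1).
have e1' : 0 < 1 - e by rewrite subr_gt0.
have h1 := mulr_ge0 (ltW e1') s0; have h2 := mulr_ge0 (ltW e1') t0.
have h3 : (1 - e) * (s + t) <= 1 - e by rewrite ler_piMr // ltW.
split; [lra|lra|lra|].
by rewrite xE; apply: vec2P; rewrite !mxE; ring.
Qed.

Lemma tri_hull a b c : conv_hull [set a; b; c] = tri a b c.
Proof.
apply/seteqP; split=> [x [k [f [y [yA f0 f1 ->]]]]|x [s [t [s0 t0 st ->]]]].
  have /choice[g hg] : forall i, exists st : R * R,
      [/\ 0 <= st.1, 0 <= st.2, st.1 + st.2 <= 1 &
          y i = a + st.1 *: (b - a) + st.2 *: (c - a)].
    move=> i; case: (yA i) => [[->|->]|->].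
    - by exists (0, 0); split=> /=; [lra|lra|lra|apply: vec2P; rewrite !mxE; ring].
    - by exists (1, 0); split=> /=; [lra|lra|lra|apply: vec2P; rewrite !mxE; ring].
    - by exists (0, 1); split=> /=; [lra|lra|lra|apply: vec2P; rewrite !mxE; ring].
  exists (\sum_i f i * (g i).1), (\sum_i f i * (g i).2); split.
  - by apply: sumr_ge0 => i _; rewrite mulr_ge0 //; case: (hg i).
  - by apply: sumr_ge0 => i _; rewrite mulr_ge0 //; case: (hg i).
  - rewrite -big_split /= -f1; apply: ler_sum => i _; rewrite -mulrDr.
    by rewrite ler_piMr //; case: (hg i).
  - rewrite !scaler_suml -[X in X + _ + _]scale1r -f1 scaler_suml -!big_split /=.
    apply: eq_bigr => i _; have [_ _ _ {1}->] := hg i.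
    by rewrite !scalerDr !scalerA.
exists 3, (fun i : 'I_3 => nth 0 [:: 1 - s - t; s; t] i),
  (fun i : 'I_3 => nth 0 [:: a; b; c] i); split.
- case=> [[|[|[|//]]] i] /=; [by left; left|by left; right|by right].
- by case=> [[|[|[|//]]] i] //=; lra.
- by rewrite !big_ord_recl big_ord0 /=; lra.
- rewrite !big_ord_recl big_ord0 /=.
  by apply: vec2P; rewrite !mxE; ring.
Qed.

End Triangles.

(** Induction on the number of intervals: one of them reaches [b], and the others must cover what
    lies to the left of it. *)
Lemma interval_cover {R : realType} (I : eqType) (s : seq I) (l r : I -> R)
    (a b : R) : (forall u, u \in s -> l u <= r u) ->
  (forall x, a < x -> x < b -> exists2 u, u \in s & l u <= x <= r u) ->
  b - a <= \sum_(u <- s) (r u - l u).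
Proof.
move: {2}(size s) (erefl (size s)) => m.
elim: m s b => [|m IH] s b sz lr cov.
  move/size0nil: sz => s0; rewrite s0 big_nil leNgt; apply/negP => ab.
  have [||u] := cov ((a + b) / 2); [lra|lra|by rewrite s0].
have [ba|ab] := leP b a.
  apply: (@le_trans _ _ 0); first by lra.
  by rewrite big_seq; apply: sumr_ge0 => u /lr; lra.
have [u us bu] : exists2 u, u \in s & b <= r u.
  apply: contrapT => h.
  (* If all right ends were below [b], a point between their maximum and [b] would be uncovered. *)
  have [M aM] : exists2 M, a <= M < b & forall u, u \in s -> r u <= M.
    have {}h u : u \in s -> r u < b.
      by move=> us; rewrite ltNge; apply/negP => bu; apply: h; exists u.
    elim: (s) h => [|v s' IHs] h; first by exists a; rewrite ?lexx.
    have [|M /andP[M0 M1] hM] := IHs.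
      by move=> u us; apply: h; rewrite inE us orbT.
    exists (Num.max M (r v)).
      by rewrite le_max M0 gt_max M1 h ?mem_head.
    move=> u; rewrite inE le_max => /predU1P[->|/hM ->//].
    by rewrite lexx orbT.
  move=> hM; have [||u us] := cov ((M + b) / 2); [lra|lra|].
  by have := hM _ us; lra.
have pe := perm_to_rem us.
rewrite (perm_big _ pe) big_cons /=.
have [la|al] := leP (l u) a.
  have : 0 <= \sum_(v <- rem u s) (r v - l v).
    by rewrite big_seq; apply: sumr_ge0 => v /mem_rem /lr; lra.
  by lra.
have : Num.min (l u) b - a <= \sum_(v <- rem u s) (r v - l v).
  apply: IH; first by rewrite size_rem // sz.
    by move=> v /mem_rem /lr.
  move=> x ax; rewrite lt_min => /andP[xl xb].
  have [v vs /andP[lx xr]] := cov x ax xb; exists v; last by rewrite lx.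
  move: vs; rewrite (perm_mem pe) inE => /predU1P[vu|//].
  by move: lx; rewrite vu leNgt xl.
by case: (leP (l u) b); have := lr _ us; lra.
Qed.

(** * Vertices, stars and sides in one triangulation *)

Section Triangulations.
Context {R : realType} {n : nat}.
Variable p : 'I_n -> 'rV[R]_2.
Hypothesis p_simple : simple_polygon p.
Hypothesis p_general : general_position p.
Implicit Types (i j k q : 'I_n) (t u : triangle n) (T : {set triangle n}).

Definition open_region t : set 'rV[R]_2 :=
  open_tri (p t.1.1) (p t.1.2) (p t.2).

Lemma triangle_regionE t :
  triangle_region p t = tri (p t.1.1) (p t.1.2) (p t.2).
Proof.
rewrite -tri_hull /triangle_region; congr conv_hull.
apply/seteqP; split=> [x [i /= + <-]|x].
  by rewrite !inE => /or3P[]/eqP ->; [left; left|left; right|right].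
by case=> [[->|->]|->]; [exists t.1.1|exists t.1.2|exists t.2];
   rewrite //= !inE eqxx ?orbT.
Qed.

Lemma nondegenerate i j k : uniq [:: i; j; k] ->
  det2 (p j - p i) (p k - p i) != 0.
Proof.
rewrite /= !inE negb_or => /andP[/andP[ij ik] /andP[jk _]].
by rewrite -crossE; exact: p_general.
Qed.

Lemma increasing_uniq t : increasing t -> uniq (vertices t).
Proof.
case: t => [[i j] k] /andP[/= ij jk]; rewrite !inE negb_or -!val_eqE /=.
by rewrite !ltn_eqF // (ltn_trans ij).
Qed.

Lemma increasing_eq t u : increasing t -> increasing u ->
  vertices t =i vertices u -> t = u.
Proof.
move=> it iu E.
have : vertices t = vertices u.
  apply: (@irr_sorted_eq _ (fun i j : 'I_n => (i < j)%N)) => //.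
  - by move=> j i k; exact: ltn_trans.
  - by move=> i; exact: ltnn.
  - by move: it => /andP[h1 h2]; rewrite /= h1 h2.
  - by move: iu => /andP[h1 h2]; rewrite /= h1 h2.
by case: t u {it iu E} => [[? ?] ?] [[? ?] ?] [-> -> ->].
Qed.

(** Undoes the increasing order of the code, so that any vertex can serve as the apex. *)
Lemma corner t k : increasing t -> k \in vertices t -> exists i j,
  [/\ triangle_region p t = tri (p k) (p i) (p j),
      open_region t = open_tri (p k) (p i) (p j),
      area p t = triangle_area (p k) (p i) (p j),
      vertices t =i [:: k; i; j] & uniq [:: k; i; j]].
Proof.
move=> /increasing_uniq; rewrite triangle_regionE /open_region /area /vertices.
case: t => [[a b] c] /=; rewrite !inE !negb_or => /andP[/andP[ab ac] /andP[bc _]].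
case/or3P => /eqP ->.
- by exists b, c; split=> //; rewrite !inE !negb_or ab ac bc.
- exists a, c; rewrite triCl open_triCl triangle_areaCl; split=> //.
    by move=> i; rewrite !inE orbCA.
  by rewrite !inE !negb_or [b == a]eq_sym ab bc ac.
- exists a, b; rewrite triCr triCl open_triCr open_triCl.
  rewrite triangle_areaCr triangle_areaCl; split=> //.
    by move=> i; rewrite !inE orbA orbC.
  by rewrite !inE !negb_or [c == a]eq_sym [c == b]eq_sym ab bc ac.
Qed.

Section OneTriangulation.
Variable T : {set triangle n}.
Hypothesis T_tri : triangulation p T.

Lemma triangle_nondegenerate t : t \in T ->
  det2 (p t.1.2 - p t.1.1) (p t.2 - p t.1.1) != 0.
Proof.
by case: T_tri => inc _ _ _ _ /inc /increasing_uniq; exact: nondegenerate.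
Qed.

Lemma triangle_sub t x : t \in T -> triangle_region p t x -> polygon_region p x.
Proof. by case: T_tri => _ _ _ _ <- tT tx; exists t. Qed.

Lemma triangle_cover x : polygon_region p x ->
  exists2 t, t \in T & triangle_region p t x.
Proof. by case: T_tri => _ _ _ _ <- [t tT tx]; exists t. Qed.

Lemma open_region_interior t x : t \in T -> open_region t x ->
  (triangle_region p t)° x.
Proof.
move=> tT tx; rewrite triangle_regionE.
have := open_tri_near (triangle_nondegenerate tT) tx.
by apply: filterS => y; exact: open_tri_sub.
Qed.

(** A point of [t] in the open triangle of [u] is a limit of points of the open triangle of [t], so
    the two interiors would meet. *)
Lemma triangle_disjoint t u x : t \in T -> u \in T ->
  triangle_region p t x -> open_region u x -> t = u.
Proof.
move=> tT uT; rewrite triangle_regionE => tx ux.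
have [y uy ty] := tri_dense tx (open_tri_near (triangle_nondegenerate uT) ux).
apply/eqP/negPn/negP => tu; case: T_tri => _ _ _ /(_ t u tT uT tu) dis _.
suff : set0 y by []. by rewrite -dis; split; exact: open_region_interior.
Qed.

Lemma vertex_in_triangle t k : t \in T -> triangle_region p t (p k) ->
  k \in vertices t.
Proof.
move=> tT; have nd := triangle_nondegenerate tT.
rewrite triangle_regionE => tk; apply/negPn/negP.
rewrite !inE !negb_or => /and3P[k1 k2 k3].
have [t12 t13 t23] : [/\ t.1.1 != t.1.2, t.1.1 != t.2 & t.1.2 != t.2].
  case: T_tri => /(_ t tT) /increasing_uniq + _ _ _ _.
  by rewrite /= !inE negb_or => /andP[/andP[-> ->] /andP[->]].
move: tk => [s [r [s0 r0 sr kE]]].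
have gp i j : i != j -> k != i -> k != j -> cross (p i) (p j) (p k) <> 0.
  by move=> ij ki kj; apply/eqP; apply: p_general => //; rewrite eq_sym.
(* General position makes the three barycentric coordinates nonzero, so [p k] would lie in the open
   triangle, a neighbourhood free of exterior points. *)
have sn0 : s != 0.
  apply/eqP => s0'; apply: (gp _ _ t13 k1 k3).
  by rewrite /cross kE s0' !mxE; ring.
have rn0 : r != 0.
  apply/eqP => r0'; apply: (gp _ _ t12 k1 k2).
  by rewrite /cross kE r0' !mxE; ring.
have srn1 : s + r != 1.
  apply/eqP => sr1; apply: (gp _ _ t23 k2 k3).
  have sE : s = 1 - r by lra.
  by rewrite /cross kE sE !mxE; ring.
have kin : open_region t (p k).
  by exists s, r; split=> //; rewrite lt_neqAle ?sr ?s0 ?r0 ?srn1 1?eq_sym ?sn0 ?rn0.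
have [y [yE]] := closure_exterior_vertex p_simple p_general
  (open_region_interior tT kin).
by move=> /(triangle_sub tT).
Qed.

Lemma star_near k : \forall y \near p k, forall t, t \in T ->
  triangle_region p t y -> k \in vertices t.
Proof.
have : \forall y \near p k, forall t, t \in [seq t <- enum T | k \notin vertices t]
    -> ~ triangle_region p t y.
  apply: near_forall_seq => t; rewrite mem_filter mem_enum => /andP[kt tT].
  rewrite triangle_regionE; apply: tri_near; first exact: triangle_nondegenerate.
  by rewrite -triangle_regionE => /(vertex_in_triangle tT); rewrite (negbTE kt).
apply: filterS => y hy t tT ty; apply/negPn/negP => kt; apply: (hy t) => //.
by rewrite mem_filter kt mem_enum.
Qed.

Lemma sides_laminar t u s s' : t \in T -> u \in T ->
  s \in sides t -> s' \in sides u ->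
  (s.1 < s'.1)%N -> (s'.1 < s.2)%N -> (s.2 < s'.2)%N -> False.
Proof.
move=> tT uT st su h1 h2 h3; case: T_tri => _ cutdiag cutdis _ _.
(* An index strictly between the two excludes consecutive vertices; an index outside excludes the
   closing edge between [n - 1] and [0]. *)
have edgeN (e : 'I_n * 'I_n) : (e.1.+1 < e.2)%N -> (0 < e.1)%N || (e.2.+1 < n)%N ->
    ~~ is_edge e.
  move=> e1 e2; rewrite /is_edge negb_or -!val_eqE /=.
  rewrite modn_small; last exact: leq_ltn_trans (ltnW e1) (ltn_ord _).
  rewrite neq_ltn e1 orbT /=.
  have := ltn_ord e.2; rewrite leq_eqVlt => /predU1P[E|lt].
    have E' : (e.2.+1 < n)%N = false by rewrite E ltnn.
    rewrite E' orbF in e2.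
    have -> : (e.2.+1 %% n)%N = 0%N by rewrite E modnn.
    by rewrite -lt0n.
  by rewrite modn_small // neq_ltn ltnS (ltnW (ltnW e1)).
have cs : is_cut T s.
  split; last by exists t.
  by apply: edgeN; [exact: leq_ltn_trans h2|rewrite (leq_ltn_trans h3) ?orbT].
have cs' : is_cut T s'.
  split; last by exists u.
  by apply: edgeN; [exact: leq_ltn_trans h3|rewrite (leq_ltn_trans _ h1)].
have ss' : s != s' by apply/eqP => E; move: h1; rewrite E ltnn.
have := @interleaved_chords_meet _ _ p p_simple p_general s.1 s.2 s'.1 s'.2.
rewrite h1 h2 h3 -!surjective_pairing => /(_ isT isT).
move=> /(_ (cutdiag _ cs) (cutdiag _ cs')) [x].
by rewrite cutdis.
Qed.

End OneTriangulation.

End Triangulations.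

(** * The star of an ear *)

Section Ear.
Context {R : realType} {n : nat}.
Variable p : 'I_n -> 'rV[R]_2.
Hypothesis p_simple : simple_polygon p.
Hypothesis p_general : general_position p.
Variables (T T' : {set triangle n}) (t : triangle n) (k i j : 'I_n).
Hypotheses (T_tri : triangulation p T) (T'_tri : triangulation p T').
Hypotheses (tT : t \in T)
  (regt : triangle_region p t = tri (p k) (p i) (p j))
  (opent : open_region p t = open_tri (p k) (p i) (p j))
  (areat : area p t = triangle_area (p k) (p i) (p j))
  (vert : vertices t =i [:: k; i; j]) (uniqt : uniq [:: k; i; j]).
Hypothesis star : forall u, u \in T -> k \in vertices u -> u != t -> u \in T'.
Implicit Types u : triangle n.

Let v := p k.
Let c1 := coord1 v (p i) (p j).
Let c2 := coord2 v (p i) (p j).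
Let nd : det2 (p i - v) (p j - v) != 0 := nondegenerate p_general uniqt.

(** The triangles by which [T'] fills the angle of [t] at [k]; [t] itself counts among them if it is
    in [T']. *)
Definition new_star u : bool :=
  [&& u \in T', k \in vertices u & ~~ ((u \in T) && (u != t))].

Lemma coord_ray (s r : R) (a b : 'rV[R]_2) :
  c1 (v + s *: (a - v) + r *: (b - v)) = s * c1 a + r * c1 b /\
  c2 (v + s *: (a - v) + r *: (b - v)) = s * c2 a + r * c2 b.
Proof.
by split; rewrite /c1 /c2 /coord1 /coord2 !mulrA -mulrDl; congr (_ / _);
   rewrite /det2 !mxE; ring.
Qed.

(* Near p k, the part of u outside t would be covered by triangles of T
   other than t, and these also belong to T'. *)
Lemma new_star_cone u a b : new_star u ->
  triangle_region p u = tri v (p a) (p b) ->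
  open_region p u = open_tri v (p a) (p b) ->
  0 <= c1 (p a) /\ 0 <= c2 (p a).
Proof.
move=> /and3P[uT' ku uN] regu openu.
suff neg (c : 'rV[R]_2 -> R) :
    (forall s r, c (v + s *: (p a - v) + r *: (p b - v)) =
       s * c (p a) + r * c (p b)) ->
    (forall x, tri v (p i) (p j) x -> 0 <= c x) -> 0 <= c (p a).
  split; apply: neg => [s r|x].
  - by have [] := coord_ray s r (p a) (p b).
  - by move=> /(triP nd)[].
  - by have [] := coord_ray s r (p a) (p b).
  - by move=> /(triP nd)[].
move=> cE c0; rewrite leNgt; apply/negP => ca.
(* The slope [eta] tilts the ray towards [p a] into the open triangle of [u], and this denominator
   keeps it so small that [c] stays negative. *)
set f := - c (p a) + `|c (p b)| + 1.
have f0 : 0 < f by rewrite /f; have := normr_ge0 (c (p b)); lra.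
pose eta := - c (p a) / f.
have eta0 : 0 < eta by rewrite divr_gt0 //; lra.
have eta1 : eta <= 1.
  by rewrite ler_pdivrMr // /f; have := normr_ge0 (c (p b)); lra.
have etac : eta * c (p b) < - c (p a).
  apply: le_lt_trans (ler_norm _) _; rewrite normrM gtr0_norm //.
  rewrite /eta mulrAC ltr_pdivrMr // ltr_pM2l; last by lra.
  by rewrite /f; lra.
have [e /andP[e0 e1] he] := near_ray_pos (star_near p_simple p_general T_tri k)
  (2^-1 *: (p a - v) + (2^-1 * eta) *: (p b - v)).
set y := _ + _ in he.
have yE : y = v + (e / 2) *: (p a - v) + (e / 2 * eta) *: (p b - v).
  by rewrite /y /v; apply: vec2P; rewrite !mxE; ring.
have yu : open_region p u y.
  rewrite openu; exists (e / 2), (e / 2 * eta); split=> //.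
  - by rewrite divr_gt0.
  - by rewrite mulr_gt0 // divr_gt0.
  - have : e / 2 * eta <= e / 2 by rewrite ler_piMr // divr_ge0 // ltW.
    by lra.
have yu' : triangle_region p u y by rewrite regu; apply: open_tri_sub; rewrite -openu.
have [u' u'T u'y] := triangle_cover T_tri (triangle_sub T'_tri uT' yu').
have ku' := he _ u'T u'y.
have [u't|u't] := eqVneq u' t.
  move: u'y; rewrite u't regt => /c0; rewrite yE cE => h.
  have : 0 < e / 2 by rewrite divr_gt0.
  move=> e20; have : e / 2 * (c (p a) + eta * c (p b)) < 0.
    by rewrite pmulr_rlt0 //; lra.
  by lra.
have u'u := triangle_disjoint p_general T'_tri (star u'T ku' u't) uT' u'y yu.
by move: uN; rewrite -u'u u'T u't.
Qed.

(** Within the cone, [c1 + c2 <= 1] describes [t], whose only polygon vertices besides [p k] are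
    [p i] and [p j]; there the sum is exactly 1. *)
Lemma new_star_radius q : q != k -> 0 <= c1 (p q) -> 0 <= c2 (p q) ->
  1 <= c1 (p q) + c2 (p q) /\
  (q \notin [:: i; j] -> 1 < c1 (p q) + c2 (p q)).
Proof.
move=> qk c10 c20.
have h : c1 (p q) + c2 (p q) <= 1 -> q \in [:: i; j].
  move=> c12; have : q \in vertices t.
    apply: (vertex_in_triangle p_simple p_general T_tri tT).
    by rewrite regt; apply/(triP nd).
  by rewrite vert !inE (negbTE qk).
split; last by move=> qij; rewrite ltNge; apply/negP => /h; rewrite (negbTE qij).
rewrite leNgt; apply/negP => lt1; move: (h (ltW lt1)); rewrite !inE.
have ci : c1 (p i) = 1 /\ c2 (p i) = 0.
  have := coord12 nd 1 0; rewrite /c1 /c2.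
  by rewrite (_ : _ + _ + _ = p i) //; apply: vec2P; rewrite !mxE; ring.
have cj : c1 (p j) = 0 /\ c2 (p j) = 1.
  have := coord12 nd 0 1; rewrite /c1 /c2.
  by rewrite (_ : _ + _ + _ = p j) //; apply: vec2P; rewrite !mxE; ring.
by move=> /orP[]/eqP qE; move: lt1; rewrite qE;
   [case: ci => -> ->|case: cj => -> ->]; lra.
Qed.

Lemma area_gt0 : 0 < area p t.
Proof. by rewrite areat /triangle_area crossE divr_gt0 // normr_gt0. Qed.

(* A triangle of the new star spans the interval [l, r] of the segment from p i
   to p j, seen from p k. *)
Lemma new_star_interval u : new_star u -> exists lr : R * R,
  [/\ lr.1 <= lr.2, (lr.2 - lr.1) * area p t <= area p u,
      u != t -> (lr.2 - lr.1) * area p t < area p u &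
      forall s e : R, 0 < e ->
        triangle_region p u (v + (e * (1 - s)) *: (p i - v) + (e * s) *: (p j - v)) ->
        lr.1 <= s <= lr.2].
Proof.
move=> nu; have /and3P[uT' ku uN] := nu.
have incu : increasing u by case: T'_tri => /(_ u uT').
have [a [b [regu openu areau vertu uniqu]]] := corner p incu ku.
have [a1 a2] := new_star_cone nu regu openu.
have [b1 b2] : 0 <= c1 (p b) /\ 0 <= c2 (p b).
  by apply: (new_star_cone nu (b := a)); [rewrite triCr|rewrite open_triCr].
have [ak bk ab] : [/\ a != k, b != k & a != b].
  move: uniqu; rewrite /= !inE negb_or => /andP[/andP[h1 h2] /andP[h3 _]].
  by split=> //; rewrite eq_sym.
have [la1 la2] := new_star_radius ak a1 a2.
have [lb1 lb2] := new_star_radius bk b1 b2.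
set la := c1 (p a) + c2 (p a) in la1 la2; set lb := c1 (p b) + c2 (p b) in lb1 lb2.
have la0 : 0 < la by lra.
have lb0 : 0 < lb by lra.
(* The rays from [v] through [p a] and [p b] meet the side from [p i] to [p j] at the parameters
   [sa] and [sb]; [la] and [lb] are the factors by which the two vertices lie beyond that side. *)
pose sa := c2 (p a) / la; pose sb := c2 (p b) / lb.
have saE : c2 (p a) = la * sa by rewrite /sa mulrC divfK ?gt_eqF.
have sbE : c2 (p b) = lb * sb by rewrite /sb mulrC divfK ?gt_eqF.
have saE' : c1 (p a) = la * (1 - sa) by rewrite mulrBr -saE /la; lra.
have sbE' : c1 (p b) = lb * (1 - sb) by rewrite mulrBr -sbE /lb; lra.
have areaE : area p u = la * lb * (`|sb - sa| * area p t).
  rewrite areau areat /triangle_area !crossE -/v.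
  set D := det2 (p i - v) (p j - v).
  have -> : det2 (p a - v) (p b - v) = la * lb * (sb - sa) * D.
    rewrite {1}(coordE nd (p a)) {1}(coordE nd (p b)) -/c1 -/c2 saE saE' sbE sbE'.
    by rewrite /D /det2 !mxE; ring.
  by rewrite !normrM (gtr0_norm la0) (gtr0_norm lb0); ring.
have au0 : 0 < area p u.
  by rewrite areau /triangle_area crossE divr_gt0 // normr_gt0 nondegenerate.
have t0 := area_gt0.
have w0 : 0 < `|sb - sa| * area p t.
  by move: au0; rewrite areaE pmulr_rgt0 // mulr_gt0.
have mmE : Num.max sa sb - Num.min sa sb = `|sb - sa|.
  by case: (leP sa sb) => h; [rewrite ger0_norm|rewrite ler0_norm]; lra.
have lalb : 1 <= la * lb by nra.
exists (Num.min sa sb, Num.max sa sb); split=> /=.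
- by rewrite ge_min le_max lexx.
- by rewrite mmE areaE ler_peMl // ltW.
- move=> ut; rewrite mmE areaE ltr_pMl //.
  (* If neither factor exceeded 1, [u] would have the vertices of [t]. *)
  have : ~~ ((a \in [:: i; j]) && (b \in [:: i; j])).
    apply: contra ut => /andP[aij bij]; apply/eqP.
    apply: increasing_eq => //; first by case: T_tri => /(_ t tT).
    move=> q; rewrite vertu vert.
    move: aij bij ab; rewrite !inE => /orP[]/eqP -> /orP[]/eqP ->;
    by rewrite ?eqxx // => _; rewrite [(q == j) || _]orbC.
  by rewrite negb_and => /orP[/la2|/lb2]; nra.
- move=> s e e0; rewrite regu => -[x [y [x0 y0 _ E]]].
  have [E1 E2] := coord12 nd (e * (1 - s)) (e * s).
  have [F1 F2] := coord_ray x y (p a) (p b).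
  move: E1 E2 F1 F2; rewrite -/v -/c1 -/c2 E => -> ->.
  rewrite saE saE' sbE sbE' => F1 F2.
  (* These equations show [s] as the mean of [sa] and [sb] with weights [x * la] and [y * lb]. *)
  have ex : e = x * la + y * lb by lra.
  have es : e * s = x * la * sa + y * lb * sb by lra.
  have xl : 0 <= x * la by rewrite mulr_ge0 // ltW.
  have yl : 0 <= y * lb by rewrite mulr_ge0 // ltW.
  have [m1 m2] : Num.min sa sb <= sa /\ Num.min sa sb <= sb.
    by rewrite !ge_min !lexx orbT.
  have [M1 M2] : sa <= Num.max sa sb /\ sb <= Num.max sa sb.
    by rewrite !le_max !lexx orbT.
  by apply/andP; split; rewrite -(ler_pM2l e0) es ex mulrDl lerD // ler_wpM2l.
Qed.

(** Close to [p k], a triangle of [T'] on the ray towards the point [s] of the opposite side has [k]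
    as a vertex. It meets the open triangle [t], so it cannot be another triangle of [T]. *)
Lemma new_star_cover (s : R) : 0 < s -> s < 1 -> exists u, new_star u /\
  exists2 e, 0 < e & triangle_region p u
    (v + (e * (1 - s)) *: (p i - v) + (e * s) *: (p j - v)).
Proof.
move=> s0 s1.
have [e /andP[e0 e1] he] := near_ray_pos
  (star_near p_simple p_general T'_tri k)
  ((1 - s) *: (p i - v) + s *: (p j - v)).
set y := _ + _ in he.
have yE : y = v + (e * (1 - s)) *: (p i - v) + (e * s) *: (p j - v).
  by rewrite /y /v; apply: vec2P; rewrite !mxE; ring.
have yt : open_region p t y.
  rewrite opent; exists (e * (1 - s)), (e * s); split=> //.
  - by rewrite mulr_gt0 // subr_gt0.
  - by rewrite mulr_gt0.
  - by lra.
have yt' : triangle_region p t y by rewrite regt; apply: open_tri_sub; rewrite -opent.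
have [u uT' uy] := triangle_cover T'_tri (triangle_sub T_tri tT yt').
exists u; split; last by exists e => //; rewrite -yE.
rewrite /new_star uT' (he _ uT' uy) /=; apply/negP => /andP[uT /eqP]; apply.
exact: (triangle_disjoint p_general T_tri uT tT uy yt).
Qed.

Lemma new_star_area : area p t <= \sum_(u | new_star u) area p u /\
  (t \notin T' -> area p t < \sum_(u | new_star u) area p u).
Proof.
have /choice[lr hlr] : forall u, exists lr : R * R, new_star u ->
    [/\ lr.1 <= lr.2, (lr.2 - lr.1) * area p t <= area p u,
      u != t -> (lr.2 - lr.1) * area p t < area p u &
      forall s e : R, 0 < e ->
        triangle_region p u (v + (e * (1 - s)) *: (p i - v) + (e * s) *: (p j - v)) ->
        lr.1 <= s <= lr.2].
  move=> u; case: (boolP (new_star u)) => nu; last by exists 0.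
  by have [lr h] := new_star_interval nu; exists lr.
have cov : 1 - 0 <= \sum_(u <- enum new_star) ((lr u).2 - (lr u).1).
  apply: interval_cover => [u|s s0 s1].
    by rewrite mem_enum => /hlr[].
  have [u [nu [e e0 uy]]] := new_star_cover s0 s1.
  by exists u; [rewrite mem_enum|have [_ _ _ h] := hlr u nu; exact: (h s e)].
rewrite subr0 big_enum /= in cov.
have t0 := area_gt0.
have cov' : area p t <= \sum_(u | new_star u) ((lr u).2 - (lr u).1) * area p t.
  by rewrite -mulr_suml ler_peMl // ltW.
split; first by apply: le_trans cov' _; apply: ler_sum => u /hlr[].
move=> tT'; apply: le_lt_trans cov' _.
(* Strict comparison of the sums needs a nonempty star; any parameter between 0 and 1 provides a
   triangle. *)
have [u0 [nu0 _]] : exists u, new_star u /\ exists2 e : R, 0 < e &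
    triangle_region p u (v + (e * (1 - 2^-1)) *: (p i - v) + (e * 2^-1) *: (p j - v)).
  by apply: new_star_cover; lra.
apply: ltr_sum; first by apply/hasP; exists u0; rewrite ?mem_index_enum.
move=> u nu; have [_ _ h _] := hlr u nu; apply: h.
by apply/eqP => ut; move: nu => /and3P[]; rewrite ut (negbTE tT').
Qed.

(** By [star], the triangles of [T] at [k] other than [t] occur in both sums and cancel, which
    leaves [new_star_area]. *)
Lemma star_area :
  \sum_(u in T | k \in vertices u) area p u <=
  \sum_(u in T' | k \in vertices u) area p u /\
  (t \notin T' -> \sum_(u in T | k \in vertices u) area p u <
     \sum_(u in T' | k \in vertices u) area p u).
Proof.
have kt : k \in vertices t by rewrite vert mem_head.
set S := \sum_(u in T | _) _; set S' := \sum_(u in T' | _) _.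
pose old u := (u \in T) && (u != t).
have SE : S = area p t + \sum_(u | [&& u \in T', k \in vertices u & old u]) area p u.
  rewrite /S (bigD1 t) ?tT //=; congr (_ + _); apply: eq_bigl => u.
  apply/idP/idP => [/andP[/andP[uT ku] ut]|/and3P[_ -> /andP[-> ->]]//].
  by rewrite /old uT ku ut (star uT ku ut).
have S'E : S' = \sum_(u | new_star u) area p u +
    \sum_(u | [&& u \in T', k \in vertices u & old u]) area p u.
  rewrite /S' (bigID old) /= addrC; congr (_ + _); apply: eq_bigl => u;
  by rewrite -andbA.
have [h1 h2] := new_star_area.
by rewrite SE S'E lerD2r ltrD2r.
Qed.

End Ear.

(** * Coordinate minima and the relative boundary of a convex hull *)

Section Boundary.
Context {R : realType} {n : nat}.
Implicit Types (A : set 'rV[R]_n) (x y : 'rV[R]_n).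

Lemma conv_hull_sub A : A `<=` conv_hull A.
Proof.
move=> x Ax; exists 1%N, (fun=> 1), (fun=> x); split=> //.
- by rewrite big_ord1.
- by rewrite big_ord1 scale1r.
Qed.

Lemma conv_hull_set1 x : conv_hull [set x] = [set x].
Proof.
apply/seteqP; split=> [y [m [c [z [zx _ c1 ->]]]]|y ->]; last exact: conv_hull_sub.
rewrite /= -[RHS]scale1r -c1 scaler_suml; apply: eq_bigr => i _.
by rewrite (zx i).
Qed.

Lemma conv_hull_coord_ge A (k : 'I_n) (mu : R) :
  (forall x, A x -> mu <= x 0 k) -> forall x, conv_hull A x -> mu <= x 0 k.
Proof.
move=> hA x [m [c [z [zA c0 c1 ->]]]].
rewrite summxE -[mu]mul1r -c1 mulr_suml; apply: ler_sum => i _.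
by rewrite !mxE ler_wpM2l // hA.
Qed.

(** Points just past [x] on the line from [y] are in the affine hull, but their coordinate [k] is
    below its minimum on the convex hull. *)
Lemma coord_min_boundary A (k : 'I_n) x y : A x -> A y ->
  (forall z, A z -> x 0 k <= z 0 k) -> x 0 k < y 0 k ->
  rel_boundary (conv_hull A) x.
Proof.
move=> Ax Ay xmin xy; split; first exact/subset_closure/conv_hull_sub.
move=> [_ /near_ray_pos h]; have [e /andP[e0 _]] := h (x - y).
have aff : aff_hull (conv_hull A) (x + e *: (x - y)).
  exists 2%N, (fun i => nth 0 [:: 1 + e; - e] i), (fun i => nth 0 [:: x; y] i).
  split.
  - by case=> [[|[|//]] i] /=; exact: conv_hull_sub.
  - by rewrite !big_ord_recl big_ord0 /=; lra.
  - rewrite !big_ord_recl big_ord0 /= addr0 scalerDl scale1r scalerBr scaleNr.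
    by rewrite addrA.
move=> /(_ aff) /(conv_hull_coord_ge xmin); rewrite !mxE.
have : 0 < e * (y 0 k - x 0 k) by rewrite mulr_gt0 // subr_gt0.
by lra.
Qed.

End Boundary.

(** * Choice of the ear, and the theorem *)

Section Peeling.
Context {R : realType} {n : nat}.
Variable p : 'I_n -> 'rV[R]_2.
Hypothesis p_simple : simple_polygon p.
Hypothesis p_general : general_position p.
Implicit Types (t u : triangle n) (T : {set triangle n}).

(** The centroid of a triangle of [T'] is covered by a triangle of [T], hence of [T'], and
    overlapping triangles of [T'] coincide. *)
Lemma triangulation_sub_eq T T' : triangulation p T -> triangulation p T' ->
  T \subset T' -> T = T'.
Proof.
move=> tT tT' /fintype.subsetP TT'; apply/eqP; rewrite finset.eqEsubset; apply/andP; split.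
  exact/fintype.subsetP.
apply/fintype.subsetP => u uT'.
have ux := open_tri_nonempty (p u.1.1) (p u.1.2) (p u.2).
set x := _ + _ in ux.
have ux' : triangle_region p u x.
  by rewrite triangle_regionE; exact: open_tri_sub.
have [t tT0 tx] := triangle_cover tT (triangle_sub tT' uT' ux').
by rewrite -(triangle_disjoint p_general tT' (TT' _ tT0) uT' tx ux).
Qed.

Definition universal u : bool := `[< forall T, triangulation p T -> u \in T >].

Lemma narrowest_ear T t u : triangulation p T -> t \in T -> ~~ universal t ->
  (forall u, u \in T -> ~~ universal u -> (t.2 - t.1.1 <= u.2 - u.1.1)%N) ->
  u \in T -> t.1.2 \in vertices u -> u != t -> universal u.
Proof.
move=> T_tri tT tC tmin uT ku ut; apply/negPn/negP => uC.
have lam := sides_laminar p_simple p_general T_tri.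
have [it iu] : increasing t /\ increasing u by case: T_tri => inc _ _ _ _; split; exact: inc.
have := tmin u uT uC; case: t u it iu tT uT ku ut {tC uC tmin} =>
  [[i k] j] [[x y] z] /andP[/= ik kj] /andP[/= xy yz] tT uT ku ut.
have ij := ltn_trans ik kj; have xz := ltn_trans xy yz.
have sidet : (i, j) \in sides (i, k, j) by rewrite !inE eqxx !orbT.
have s1 : (x, y) \in sides (x, y, z) by rewrite !inE eqxx.
have s2 : (y, z) \in sides (x, y, z) by rewrite !inE eqxx !orbT.
have s3 : (x, z) \in sides (x, y, z) by rewrite !inE eqxx !orbT.
(* A side of [u] from [k] to an index beyond [j] would interleave with the side [(i, j)] of [t];
   [left] is the mirror image. *)
have right a b : (a, b) \in sides (x, y, z) -> a = k -> (b <= j)%N.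
  move=> sab ak; rewrite leqNgt; apply/negP => jb.
  by apply: (lam _ _ _ _ tT uT sidet sab); rewrite /= ?ak.
have left a b : (a, b) \in sides (x, y, z) -> b = k -> (i <= a)%N.
  move=> sab bk; rewrite leqNgt; apply/negP => ai.
  by apply: (lam _ _ _ _ uT tT sab sidet); rewrite /= ?bk.
move: ku; rewrite !inE => /or3P[]/eqP /= kE.
- apply/negP; rewrite -ltnNge.
  have zj := right _ _ s3 (esym kE).
  apply: (@leq_ltn_trans (j - x)); first exact: leq_sub2r.
  by rewrite ltn_sub2l // -kE.
(* With [k] in the middle of [u] as well, the extremes of [u] lie between [i] and [j], and
   minimality makes them equal to [i] and [j]. *)
- have zj := right _ _ s2 (esym kE); have ix := left _ _ s1 (esym kE).
  move=> h; move/negP: ut; apply.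
  have xi : (x <= i)%N.
    rewrite leqNgt; apply/negP => ilx; move: h; apply/negP; rewrite -ltnNge.
    apply: (@leq_ltn_trans (j - x)); first exact: leq_sub2r.
    by rewrite ltn_sub2l // (ltn_trans xy) // -kE.
  have xE : x = i by apply: ord_inj; apply/eqP; rewrite eqn_leq xi ix.
  have jz : (j <= z)%N.
    rewrite leqNgt; apply/negP => zlj; move: h; apply/negP; rewrite -ltnNge xE.
    by rewrite ltn_sub2r.
  have zE : z = j by apply: ord_inj; apply/eqP; rewrite eqn_leq zj jz.
  by rewrite xE zE kE.
- apply/negP; rewrite -ltnNge.
  have ix := left _ _ s3 (esym kE).
  apply: (@leq_ltn_trans (z - i)); first exact: leq_sub2l.
  by rewrite ltn_sub2r // -kE.
Qed.

End Peeling.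

Theorem theorem3p5 (R : realType) (n : nat) (p : 'I_n -> 'rV[R]_2)
    (p_simple : simple_polygon p) (p_general : general_position p)
    (T : {set triangle n}) (T_triangulation : triangulation p T) :
  polytope_boundary (secondary_polytope p) (area_vector p T).
Proof.
have [[u0 u0T u0C]|allC] := pselect (exists2 u, u \in T & ~~ universal p u).
  left; pose P u := (u \in T) && ~~ universal p u.
  have Pu0 : P u0 by rewrite /P u0T.
  case: (arg_minnP (fun u : triangle n => (u.2 - u.1.1)%N) Pu0) =>
    t /andP[tT tC] tmin.
  have inct : increasing t by case: T_triangulation => /(_ t tT).
  have kt : t.1.2 \in vertices t by rewrite !inE eqxx orbT.
  have [i [j [regt opent areat vert uniqt]]] := corner p inct kt.
  have earC u : u \in T -> t.1.2 \in vertices u -> u != t -> universal p u.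
    apply: (narrowest_ear p_simple p_general T_triangulation tT tC).
    by move=> u' u'T u'C; apply: tmin; rewrite /P u'T.
  have [T0 [T0_tri tT0]] : exists T0, triangulation p T0 /\ t \notin T0.
    apply: contrapT => h; move/negP: tC; apply; apply/asboolP => T' T'_tri.
    by apply/negPn/negP => tT'; apply: h; exists T'.
  have starC T' : triangulation p T' -> forall u, u \in T ->
      t.1.2 \in vertices u -> u != t -> u \in T'.
    by move=> T'_tri u uT ku ut; have /asboolP := earC u uT ku ut; apply.
  have key T' (T'_tri : triangulation p T') :=
    star_area p_simple p_general T_triangulation T'_tri tT regt opent areat vert
      uniqt (starC T' T'_tri).
  apply: (@coord_min_boundary _ _ _ t.1.2 _ (area_vector p T0)).
  - by exists T.
  - by exists T0.
  - move=> _ [T' T'_tri <-]; rewrite !mxE.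
    by have [] := key T' T'_tri.
  - rewrite !mxE.
    by have [_] := key T0 T0_tri; apply.
(* With every triangle of [T] universal, the polytope is one point, the second clause of
   [polytope_boundary]. *)
right; rewrite /secondary_polytope -conv_hull_set1; congr conv_hull.
apply/seteqP; split=> [x [T' T'_tri <-]|_ ->]; last by exists T.
rewrite (@triangulation_sub_eq _ _ p p_general T T') //.
apply/fintype.subsetP => u uT; apply: contrapT => uT'; apply: allC; exists u => //.
by apply/negP => /asboolP /(_ T' T'_tri).
Qed.
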